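(* The function $V(x):=E[\tau(x)A(x)]$ is the solution of the problem $$\begin{cases}\frac12 V''(x)-\mu V'(x)=-\dfrac{3x^2}{2\mu}-\dfrac{x}{2\mu^2},\\[4pt] V(0)=0,\\ \lim_{\mu\to+\infty}V(x)=0.\end{cases}$$ Here $'$ denotes differentiation in $x$, and in the last condition $V(x)$ is regarded, for fixed $x$, as a function of the drift parameter $\mu$.
   Context: Let $B_t$ be a standard one-dimensional Brownian motion. For $x>0$ and $\mu>0$ let $X(t)=x-\mu t+B_t$ (Brownian motion with negative drift $-\mu$ started at $x$). The first-passage time below zero is $\tau(x)=\tau^\mu(x)=\inf\{t>0: X(t)\le 0\}$ (finite with probability one), and the first-passage area is $A(x)=A^\mu(x)=\int_0^{\tau(x)}X(t)\,dt$. For starting point $0$ one has $\tau(0)=0$ and $A(0)=0$.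
   Formalization: ''The solution'': V+e^{-μ²}(e^{2μx}-1) also solves the problem, so uniqueness is proved as: for fixed μ every solution of the ODE, continuous at 0 with value 0 there, is V+c(e^{2μx}-1), and a c independent of μ is forced to be 0 by the limit condition. *)

(* Defs.v *)
From HB Require Import structures.
From mathcomp Require Import all_boot all_order all_algebra.
From mathcomp Require Import all_classical all_reals all_analysis.
Import Order.TTheory GRing.Theory Num.Theory.
Import numFieldNormedType.Exports.

Set Implicit Arguments.
Unset Strict Implicit.
Unset Printing Implicit Defensive.

Local Open Scope classical_set_scope.
Local Open Scope ring_scope.

Section brownian_motion.
Context {R : realType} {d : measure_display} {Omega : measurableType d}.
Variables (P : probability Omega R) (B : R -> {RV P >-> R}).

(* Only the times t >= 0 matter: the values of B at negative times are
   unconstrained. In the second clause any finite sequence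
   0 <= t_0 <= ... <= t_n arises as an initial segment of such a t. *)
Definition standard_brownian_motion : Prop :=
  [/\ {ae P, forall w, B 0 w = 0},
      forall (t : nat -> R) (n : nat) (U : nat -> set R),
        0 <= t 0%N -> {homo t : i j / (i <= j)%N >-> i <= j} ->
        (forall i, measurable (U i)) ->
        P (\bigcap_(i in `I_n) (B (t i.+1) \- B (t i)) @^-1` U i) =
        (\prod_(i < n) P ((B (t i.+1) \- B (t i))%R @^-1` U i))%E,
      forall s t : R, 0 <= s -> s < t ->
        forall U : set R, measurable U ->
          P ((B t \- B s) @^-1` U) = normal_prob 0 (Num.sqrt (t - s)) U &
      {ae P, forall w, {within `[0, +oo[, continuous (fun t => B t w)}}].

Variables mu x : R.

Definition drifted (t : R) (w : Omega) : R := x - mu * t + B t w.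

(* +oo when the path stays positive. At x = 0 the value 0 is not imposed: it
   holds almost surely, as a property of Brownian paths. *)
Definition first_passage_time (w : Omega) : \bar R :=
  ereal_inf [set t%:E | t in [set t : R | 0 < t /\ drifted t w <= 0]].

Definition first_passage_area (w : Omega) : \bar R :=
  (\int[lebesgue_measure]_(t in
     [set t : R | (0 <= t)%R /\ t%:E <= first_passage_time w])
     (drifted t w)%:E)%E.

Definition mean_time_area : \bar R :=
  (\int[P]_w (first_passage_time w * first_passage_area w))%E.

End brownian_motion.

(* Continuity at 0 from the right ties the boundary value f 0 to the values of
   f on the open half-line, where the equation is imposed. *)
Definition solves_ode {R : realType} (mu : R) (f : R -> R) : Prop :=
  [/\ forall x, 0 < x ->
        [/\ derivable f x 1,
            derivable (derive1 f) x 1 &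
            2^-1 * derive1 (derive1 f) x - mu * derive1 f x =
              - (3 * x ^+ 2 / (2 * mu)) - x / (2 * mu ^+ 2)],
      f y @[y --> 0^'+] --> f 0 &
      f 0 = 0].

Definition solves_problem {R : realType} (V : R -> R -> R) : Prop :=
  (forall mu, 0 < mu -> solves_ode mu (V mu)) /\
  (forall x, 0 < x -> V mu x @[mu --> +oo] --> 0).

(* Main.v *)
Require Import Defs.
From HB Require Import structures.
From mathcomp Require Import all_boot all_order all_algebra.
From mathcomp Require Import all_classical all_reals all_analysis.
From mathcomp Require Import measurable_realfun.
From mathcomp Require Import ring lra.
Import Order.TTheory GRing.Theory Num.Theory.
Import numFieldNormedType.Exports.

Local Open Scope classical_set_scope.
Local Open Scope ring_scope.

(* Proof idea. The ODE is solved by the polynomial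
   V x = x^3/(2 mu^2) + x^2/mu^3 + x/mu^4, so everything rests on E[tau A] = V x.
   Sample the drifted path on the grid of mesh dl and stop the resulting Gaussian
   walk S when it first becomes nonpositive; let t be dl times the number of steps
   taken and a the Riemann sum of the area. With corrections of order dl to the
   coefficients, t a + t E[A](S) + a E[tau](S) + V(S) is an exact martingale, so
   E[t a] differs from V x only by the remaining three terms at the end. These are
   small: either S has overshot 0, by at most the largest increment, whose fourth
   moment is of order dl in total, or the walk is still positive at the horizon H,
   which costs expR (- mu^2 H / 2) by an exponential moment.
   Pathwise, if the oscillation of the path at scale dl is below eta, the walks
   started from x - eta and x + eta give t a below and above tau A. Hence no
   measurability of tau and A is needed: tau A is squeezed between measurable
   functions (Fatou's lemma from above, truncation and a second moment bound from
   below), and eta tends to 0 by continuity of V. *)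

(** * Random variables with all moments *)

Section normal_law.
Context {R : realType}.
Local Notation leb := (@lebesgue_measure R).

(** The scale below which a path oscillates by less than [eta] depends on the path. No single mesh
    therefore serves all paths, and the comparison with the walks holds only eventually in the mesh;
    this is why Fatou's lemma replaces a uniform estimate. The error of the walk has the form K1 / H
    + K2(H) dl with K2 growing in H, which fixes the order of the limits: the mesh first, then the
    horizon, then [eta]. The martingale is found by seeking p with t a + p(t, a, s) preserved in
    mean by one step. Linearity in t and a forces their coefficients to be the mean area and the
    mean time from s; the remaining term is the mean product itself. As p is cubic in s, one step
    involves only the first three moments of a Gaussian increment, so the corrections of order dl
    make the identity exact instead of asymptotic. *)

Lemma ge0_integral_normal_prob (m s : R) (f : R -> \bar R) :
  measurable_fun setT f -> (forall x, 0 <= f x)%E ->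
  (\int[normal_prob m s]_x f x =
   \int[leb]_x (f x * (normal_pdf m s x)%:E))%E.
Proof.
move=> mf f0.
have dom : normal_prob m s `<< leb := normal_prob_dominates m s.
rewrite -(Radon_Nikodym_SigmaFinite.change_of_variables dom f0)//.
apply: ae_eq_integral => //.
- apply: emeasurable_funM => //.
  exact: measurable_int (Radon_Nikodym_SigmaFinite.f_integrable dom).
- apply: emeasurable_funM => //; apply/measurable_EFinP.
  exact: measurable_normal_pdf.
(* The Radon-Nikodym derivative and the density have equal integrals over every measurable set,
   hence agree almost everywhere. *)
- apply: ae_eqe_mul2l; apply: integral_ae_eq => //.
  + exact: Radon_Nikodym_SigmaFinite.f_integrable.
  + by apply/measurable_EFinP; exact: measurable_normal_pdf.
  + by move=> E _ mE; rewrite -Radon_Nikodym_SigmaFinite.f_integral.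
Qed.

(* Completing the square: tilting the centred normal density by [expR (th x)]
   recentres it at [th s ^+ 2]. *)
Lemma mgf_normal_prob (s th : R) : s != 0 ->
  (\int[normal_prob 0 s]_x (expR (th * x))%:E =
   (expR (th ^+ 2 * s ^+ 2 / 2))%:E)%E.
Proof.
move=> s0; rewrite ge0_integral_normal_prob; last 2 first.
- by apply/measurable_EFinP; apply: measurableT_comp => //; exact: measurable_funM.
- by move=> x; rewrite lee_fin expR_ge0.
transitivity (\int[leb]_x ((expR (th ^+ 2 * s ^+ 2 / 2))%:E *
    (normal_pdf (th * s ^+ 2) s x)%:E))%E; last first.
  rewrite ge0_integralZl_EFin ?integral_normal_pdf ?mule1//.
  - by move=> x _; rewrite lee_fin normal_pdf_ge0.
  - by apply/measurable_EFinP; exact: measurable_normal_pdf.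
apply: eq_integral => x _; rewrite -!EFinM; congr EFin.
rewrite /normal_pdf (negbTE s0) mulrCA [RHS]mulrCA; congr (_ * _).
rewrite /normal_fun -!expRD; congr expR.
by field.
Qed.

End normal_law.

Section moments.
Context {d : measure_display} {T : measurableType d} {R : realType}.
Variable P : probability T R.
Implicit Types X Y : T -> R.

(** A class closed under sums and products, so that every polynomial in the walk is integrable
    without tracking degrees. *)
Definition has_moments X : Prop := measurable_fun setT X /\
  forall n : nat, P.-integrable setT (fun w => (`|X w| ^+ n)%:E).

Local Notation E X := (\int[P]_w X w)%R.

Lemma has_moments_measurable X : has_moments X -> measurable_fun setT X.
Proof. by case. Qed.

Lemma has_moments_integrable X :
  has_moments X -> P.-integrable setT (EFin \o X).
Proof.
case=> mX /(_ 1%N); apply: le_integrable => //; first exact/measurable_EFinP.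
by move=> w _ /=; rewrite lee_fin expr1 normr_id.
Qed.

Lemma has_moments_le X Y : measurable_fun setT X -> has_moments Y ->
  (forall w, `|X w| <= `|Y w|) -> has_moments X.
Proof.
move=> mX [mY iY] XY; split => // n; apply: le_integrable (iY n) => //.
  apply/measurable_EFinP/measurable_funX.
  exact: measurableT_comp.
move=> w _ /=; rewrite lee_fin !normrX !normr_id.
by rewrite lerXn2r ?nnegrE.
Qed.

Lemma has_moments_cst c : has_moments (fun=> c).
Proof.
split=> [|n]; first exact: measurable_cst.
exact: (finite_measure_integrable_cst P (`|c| ^+ n)).
Qed.

Lemma has_momentsD X Y : has_moments X -> has_moments Y ->
  has_moments (fun w => X w + Y w).
Proof.
move=> [mX iX] [mY iY]; split; first exact: measurable_funD.
move=> n.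
have i2 : P.-integrable setT
    (fun w => ((2 ^+ n) * `|X w| ^+ n + (2 ^+ n) * `|Y w| ^+ n)%:E).
  have := integrableD measurableT (integrableZl measurableT (2 ^+ n) (iX n))
    (integrableZl measurableT (2 ^+ n) (iY n)).
  by apply: eq_integrable => // w _; rewrite EFinD !EFinM.
apply: le_integrable i2 => //.
  apply/measurable_EFinP/measurable_funX/measurableT_comp => //.
  exact: measurable_funD.
move=> w _ /=; rewrite lee_fin normrX normr_id [leRHS]ger0_norm; last first.
  by rewrite addr_ge0// ?mulr_ge0// ?exprn_ge0.
rewrite -!exprMn; have [XY|/ltW YX] := leP `|X w| `|Y w|.
- apply: (le_trans (y := (2 * `|Y w|) ^+ n)); last first.
    by rewrite lerDr exprn_ge0// mulr_ge0.
  rewrite lerXn2r ?nnegrE ?mulr_ge0//.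
  by apply: (le_trans (ler_normD _ _)); rewrite mulr2n mulrDl mul1r lerD2r.
- apply: (le_trans (y := (2 * `|X w|) ^+ n)); last first.
    by rewrite lerDl exprn_ge0// mulr_ge0.
  rewrite lerXn2r ?nnegrE ?mulr_ge0//.
  by apply: (le_trans (ler_normD _ _)); rewrite mulr2n mulrDl mul1r lerD2l.
Qed.

Lemma has_momentsM X Y : has_moments X -> has_moments Y ->
  has_moments (fun w => X w * Y w).
Proof.
move=> [mX iX] [mY iY]; split; first exact: measurable_funM.
move=> n.
have i2 : P.-integrable setT
    (fun w => (`|X w| ^+ (n + n) + `|Y w| ^+ (n + n))%:E).
  have := integrableD measurableT (iX (n + n)%N) (iY (n + n)%N).
  by apply: eq_integrable => // w _; rewrite EFinD.
apply: le_integrable i2 => //.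
  apply/measurable_EFinP/measurable_funX/measurableT_comp => //.
  exact: measurable_funM.
move=> w _ /=; rewrite lee_fin normrX normr_id [leRHS]ger0_norm; last first.
  by rewrite addr_ge0// ?exprn_ge0.
rewrite normrM exprMn !exprD.
set a := `|X w| ^+ n; set b := `|Y w| ^+ n.
have a0 : 0 <= a by rewrite exprn_ge0.
have b0 : 0 <= b by rewrite exprn_ge0.
nra.
Qed.

Lemma has_momentsZ c X : has_moments X -> has_moments (fun w => c * X w).
Proof. by move=> hX; apply: has_momentsM => //; exact: has_moments_cst. Qed.

Lemma has_momentsN X : has_moments X -> has_moments (fun w => - X w).
Proof.
move=> hX; apply: (has_moments_le _ _ _ hX) => [|w]; last by rewrite normrN.
exact: measurableT_comp (has_moments_measurable _ hX).
Qed.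

Lemma has_momentsB X Y : has_moments X -> has_moments Y ->
  has_moments (fun w => X w - Y w).
Proof. by move=> hX hY; apply: has_momentsD => //; exact: has_momentsN. Qed.

Lemma has_momentsX n X : has_moments X -> has_moments (fun w => X w ^+ n).
Proof.
move=> hX; elim: n => [|n ih]; first exact: has_moments_cst.
by under eq_fun do rewrite exprS; exact: has_momentsM.
Qed.

Lemma has_moments_sum n (X : nat -> T -> R) : (forall k, has_moments (X k)) ->
  has_moments (fun w => \sum_(i < n) X i w).
Proof.
move=> hX; elim: n => [|n ih].
  by under eq_fun do rewrite big_ord0; exact: has_moments_cst.
by under eq_fun do rewrite big_ord_recr /=; exact: has_momentsD.
Qed.

Lemma exprn_le_expR (x : R) n : `|x| ^+ n <= n`!%:R * (expR x + expR (- x)).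
Proof.
have f0 : 0 < n`!%:R :> R by rewrite ltr0n fact_gt0.
rewrite mulrC -ler_pdivrMr//; apply: (@le_trans _ _ (expR `|x|)).
  case: n {f0} => [|n]; first by rewrite expr0 fact0 divr1 -[leLHS](@expR0 R) ler_expR.
  by apply: le_trans (expR_ge1Dxn n (normr_ge0 x)); rewrite lerDr.
have := expR_ge0 x; have := expR_ge0 (- x).
by case: (ler0P x) => _; lra.
Qed.

Lemma has_moments_mgf X : measurable_fun setT X ->
  (forall th, P.-integrable setT (fun w => (expR (th * X w))%:E)) ->
  has_moments X.
Proof.
move=> mX iX; split=> // n.
have := integrableZl measurableT n`!%:R
  (integrableD measurableT (iX 1) (iX (-1))).
apply: le_integrable => //.
  exact/measurable_EFinP/measurable_funX/measurableT_comp.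
move=> w _ /=; rewrite lee_fin mul1r mulN1r ger0_norm ?exprn_ge0//.
by apply: le_trans (ler_norm _); exact: exprn_le_expR.
Qed.

Lemma expectD X Y : has_moments X -> has_moments Y ->
  E (fun w => X w + Y w) = E X + E Y.
Proof.
by move=> /has_moments_integrable hX /has_moments_integrable hY; rewrite RintegralD.
Qed.

Lemma expectZ c X : has_moments X -> E (fun w => c * X w) = c * E X.
Proof. by move=> /has_moments_integrable hX; rewrite RintegralZl. Qed.

Lemma expectB X Y : has_moments X -> has_moments Y ->
  E (fun w => X w - Y w) = E X - E Y.
Proof.
by move=> /has_moments_integrable hX /has_moments_integrable hY; rewrite RintegralB.
Qed.

Lemma expect_cst c : E (fun=> c) = c.
Proof. by rewrite Rintegral_cst//= probability_setT/= mulr1. Qed.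

Lemma expect_le X Y : has_moments X -> has_moments Y ->
  (forall w, X w <= Y w) -> E X <= E Y.
Proof.
by move=> /has_moments_integrable hX /has_moments_integrable hY ?; apply: le_Rintegral.
Qed.

Lemma expect_sum n (X : nat -> T -> R) : (forall k, has_moments (X k)) ->
  E (fun w => \sum_(i < n) X i w) = \sum_(i < n) E (X i).
Proof.
move=> hX; elim: n => [|n ih].
  under eq_Rintegral do rewrite big_ord0.
  by rewrite expect_cst big_ord0.
under eq_Rintegral do rewrite big_ord_recr /=.
by rewrite expectD ?big_ord_recr ?ih//; exact: has_moments_sum.
Qed.

End moments.

(** * Independence and expectations of products *)

Section independence.
Context {d : measure_display} {T : measurableType d} {R : realType}.
Variable P : probability T R.

Definition independent_rv (X Y : T -> R) : Prop :=
  forall U V : set R, measurable U -> measurable V ->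
    P (X @^-1` U `&` Y @^-1` V) = (P (X @^-1` U) * P (Y @^-1` V))%E.

(** Independence says that the law of the pair agrees with the product law on rectangles, hence
    everywhere; Fubini's theorem then splits the integral. *)
Lemma mfun_independent_expectM (X Y : {mfun T >-> R}) :
  independent_rv X Y -> has_moments P X -> has_moments P Y ->
  \int[P]_w (X w * Y w) = \int[P]_w X w * \int[P]_w Y w.
Proof.
move=> XY hX hY.
have mZ : measurable_fun setT (fun w => (X w, Y w)).
  exact: measurable_fun_pair.
pose Z : {mfun T >-> (R * R)%type} :=
  HB.pack (fun w => (X w, Y w)) (isMeasurableFun.Build _ _ _ _ _ mZ).
have mf : measurable_fun setT (fun z : R * R => (z.1 * z.2)%:E).
  by apply/measurable_EFinP; exact: measurable_funM.
have eqm A : measurable A -> A `<=` setT ->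
    distribution P Z A = (distribution P X \x distribution P Y)%E A.
  move=> mA _; apply/esym; apply: product_measure_unique => //.
have iXY : P.-integrable setT (fun w => (X w * Y w)%:E).
  exact: has_moments_integrable (has_momentsM _ _ _ hX hY).
have iZ : (distribution P Z).-integrable setT (fun z => (z.1 * z.2)%:E).
  exact: integrable_pushforward.
have iXxY : (distribution P X \x distribution P Y)%E.-integrable setT
    (fun z => (z.1 * z.2)%:E).
  apply/integrableP; split => //.
  rewrite (eq_measure_integral (distribution P Z)).
    by case/integrableP : iZ.
  by move=> S mS sS; exact/esym/eqm.
have iX := has_moments_integrable _ _ hX.
have iY := has_moments_integrable _ _ hY.
rewrite /Rintegral -fineM; last 2 first.
- exact: integrable_fin_num.
- exact: integrable_fin_num.
congr fine.
transitivity (\int[distribution P Z]_z (z.1 * z.2)%:E)%E.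
  by rewrite integral_pushforward.
rewrite (eq_measure_integral _ eqm) -(integral12_prod_meas1 iXxY).
rewrite /fubini_F/=.
transitivity (\int[distribution P X]_x (x%:E * \int[P]_w (Y w)%:E))%E.
  apply: eq_integral => x _.
  under eq_integral do rewrite EFinM.
  rewrite integralZl//; last exact: integrable_pushforward.
  by rewrite integral_pushforward.
rewrite -(fineK (integrable_fin_num measurableT iY)).
rewrite integralZr//; last exact: integrable_pushforward.
by rewrite integral_pushforward.
Qed.

Lemma independent_expectM (X Y : T -> R) :
  independent_rv X Y -> has_moments P X -> has_moments P Y ->
  \int[P]_w (X w * Y w) = \int[P]_w X w * \int[P]_w Y w.
Proof.
move=> XY hX hY.
pose X' : {mfun T >-> R} := HB.pack X
  (isMeasurableFun.Build _ _ _ _ _ (has_moments_measurable _ _ hX)).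
pose Y' : {mfun T >-> R} := HB.pack Y
  (isMeasurableFun.Build _ _ _ _ _ (has_moments_measurable _ _ hY)).
exact: (@mfun_independent_expectM X' Y').
Qed.

(** Expresses adaptedness: [G] will consist of events about the increments already used. *)
Definition measurable_for (G : set (set T)) (X : T -> R) : Prop :=
  measurable_fun (setT : set (g_sigma_algebraType G)) X.

Lemma measurable_for_measurable (G : set (set T)) (X : T -> R) :
  G `<=` measurable -> measurable_for G X -> measurable_fun setT X.
Proof.
move=> Gm mX _ U mU; have := mX measurableT U mU.
by apply: smallest_sub => //; exact: sigma_algebra_measurable.
Qed.

Lemma pi_independent_expectM (G : set (set T)) (X Y : T -> R) (f : R -> R) :
  setI_closed G -> G setT -> G `<=` measurable -> measurable_fun setT Y ->
  (forall A V, G A -> measurable V ->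
    P (A `&` Y @^-1` V) = (P A * P (Y @^-1` V))%E) ->
  measurable_for G X -> measurable_fun setT f ->
  has_moments P X -> has_moments P (f \o Y) ->
  \int[P]_w (X w * f (Y w)) = \int[P]_w X w * \int[P]_w f (Y w).
Proof.
move=> GI GT Gm mY GY mX mf hX hfY; apply: (independent_expectM X (f \o Y)) => //.
move=> U V mU mV.
have mYV : measurable ((f \o Y) @^-1` V).
  by rewrite -[X in measurable X]setTI; apply: measurableT_comp.
have mfV : measurable (f @^-1` V) by rewrite -[X in measurable X]setTI; exact: mf.
pose Q (A : set T) := P (A `&` (f \o Y) @^-1` V) = (P A * P ((f \o Y) @^-1` V))%E.
have sm (A : set T) : <<s G >> A -> measurable A.
  by apply: smallest_sub => //; exact: sigma_algebra_measurable.
have QC (S : set T) : measurable S -> Q S -> Q (~` S).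
  move=> mS QS; rewrite /Q.
  have -> : P (~` S `&` (f \o Y) @^-1` V) =
      (P ((f \o Y) @^-1` V) - P (S `&` (f \o Y) @^-1` V))%E.
    rewrite setIC -setDE measureD//; last by rewrite ltey_eq fin_num_measure.
    by congr (_ - P _)%E; exact: setIC.
  rewrite QS probability_setC//.
  by rewrite muleBl ?mul1e// ?fin_num_measure// fin_num_adde_defr ?fin_num_measure.
have QU (F : (set T)^nat) : (forall n, measurable (F n)) ->
    trivIset setT F -> (forall n, Q (F n)) -> Q (\bigcup_k F k).
  move=> mF tF QF; rewrite /Q setI_bigcupl !measure_bigcup//; last 2 first.
  + by move=> n _; exact: measurableI.
  + exact: trivIset_setIr.
  rewrite muleC -(fineK (fin_num_measure P _ mYV)) -nneseriesZl//.
  by apply: eq_eseriesr => n _; rewrite fineK ?fin_num_measure// muleC; exact: QF.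
suff GPI A : <<s G >> A -> Q A.
  by apply: GPI; have := mX measurableT U mU; rewrite setTI.
apply: (@dynkin_induction _ (g_sigma_algebraType G) G Q) => //.
- by rewrite /Q setTI probability_setT mul1e.
- by move=> S GS; exact: (GY S (f @^-1` V)).
- by move=> S /sm; exact: QC.
- by move=> F mF; apply: QU => n; apply: sm; exact: mF.
Qed.

End independence.

(** * Moments of Gaussian variables *)

Section taylor.
Context {R : realType}.

Lemma expR_taylor3 (u : R) :
  `|expR u - (1 + u + u ^+ 2 / 2 + u ^+ 3 / 6)| <= u ^+ 4 * expR `|u|.
Proof.
pose p := 1 + u + u ^+ 2 / 2 + u ^+ 3 / 6.
have cu (v : R) : series (exp_coeff v) @ \oo --> expR v.
  exact: is_cvg_series_exp_coeff.
have ub n : series (exp_coeff `|u|) n <= expR `|u|.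
  apply: nondecreasing_cvgn_le; last exact: is_cvg_series_exp_coeff.
  by apply: nondecreasing_series => k _ _; rewrite exp_coeff_ge0.
have bnd n : `|series (exp_coeff u) (4 + n)%N - p| <= u ^+ 4 * expR `|u|.
  (* Beyond the cubic part, each term is at most [u ^+ 4] times a term of the series at [|u|],
     because (4 + k)! >= k!. *)
  have -> : series (exp_coeff u) (4 + n)%N - p =
      \sum_(k < n) exp_coeff u (4 + k)%N.
    rewrite /series /= big_mkord big_split_ord /= /p !big_ord_recl big_ord0 /=.
    rewrite /exp_coeff /= /bump /= !factS fact0.
    set S := (X in _ + X - _); rewrite [X in _ = X](_ : _ = S)//; first by field.
  apply: (le_trans (ler_norm_sum _ _ _)).
  apply: (le_trans (y := u ^+ 4 * series (exp_coeff `|u|) n)); last first.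
    by rewrite ler_wpM2l ?ub// exprn_even_ge0.
  rewrite /series /= big_mkord mulr_sumr; apply: ler_sum => k _.
  rewrite /exp_coeff /= normrM normrX exprD normfV (ger0_norm (ler0n _ _)).
  rewrite -mulrA -(ger0_norm (exprn_even_ge0 u (isT : ~~ odd 4))) normrX.
  rewrite ler_wpM2l ?exprn_ge0// ler_wpM2l ?exprn_ge0//.
  rewrite lef_pV2 ?posrE ?ltr0n ?fact_gt0// ler_nat.
  exact: leq_fact (leq_addl _ _).
have cvu : `|series (exp_coeff u) (4 + n)%N - p| @[n --> \oo] --> `|expR u - p|.
  apply: cvg_norm; apply: cvgB; last exact: cvg_cst.
  by have := cu u; rewrite -(cvg_shiftn 4); under eq_fun do rewrite addnC.
rewrite -(cvg_lim _ cvu)//; apply: limr_le; first by apply/cvg_ex; exists (`|expR u - p|).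
by apply: nearW => n; exact: bnd.
Qed.

Lemma eq0_le_small (a M : R) :
  (forall th, 0 < th -> th <= 1 -> `|a| <= M * th) -> a = 0.
Proof.
move=> h; apply/eqP; rewrite -normr_le0; apply/ler_addgt0Pr => e e0.
rewrite add0r; have M0 : 0 <= M.
  by have := h 1 ltr01 (lexx _); rewrite mulr1; exact: le_trans.
pose th := Num.min 1 (e / (M + 1)).
have th0 : 0 < th by rewrite lt_min ltr01 divr_gt0// ltr_wpDl.
apply: (le_trans (h _ th0 _)); first by rewrite ge_min lexx.
apply: (le_trans (y := M * (e / (M + 1)))).
  by rewrite ler_wpM2l// ge_min lexx orbT.
rewrite mulrA ler_pdivrMr ?ltr_wpDl//; nra.
Qed.

(** Divide by [th] and let it tend to 0, once per coefficient. This reads moments off a moment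
    generating function without differentiating under the integral. *)
Lemma cubic_coefs_eq0 (a b c K : R) :
  (forall th, 0 < th -> th <= 1 ->
    `|a * th + b * th ^+ 2 + c * th ^+ 3| <= K * th ^+ 4) ->
  [/\ a = 0, b = 0 & c = 0].
Proof.
move=> h.
have divth (th x y : R) : 0 < th -> `|x * th| <= y * th -> `|x| <= y.
  by move=> th0; rewrite normrM (gtr0_norm th0) ler_pM2r.
have small (x y M N th : R) : 0 <= th -> `|x + y * th| <= M * th -> `|y| <= N ->
    `|x| <= (M + N) * th.
  move=> th0 xy yN; rewrite -[x](addrK (y * th)) (le_trans (ler_normB _ _))//.
  by rewrite mulrDl lerD// normrM (ger0_norm th0) ler_wpM2r.
have h1 th : 0 < th -> th <= 1 -> `|a + (b + c * th) * th| <= `|K| * th.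
  move=> th0 th1; apply: (divth th) => //.
  have -> : (a + (b + c * th) * th) * th = a * th + b * th ^+ 2 + c * th ^+ 3.
    by ring.
  have t42 : th ^+ 4 <= th ^+ 2 by apply: ler_wiXn2l => //; exact: ltW.
  apply: (le_trans (h _ th0 th1)); apply: (le_trans (ler_norm _)).
  rewrite normrM (ger0_norm (exprn_ge0 4 (ltW th0))) -mulrA -expr2.
  exact: ler_wpM2l.
have a0 : a = 0.
  apply: (@eq0_le_small a (`|K| + (`|b| + `|c|))) => th th0 th1.
  apply: small (h1 _ th0 th1) _; first exact: ltW.
  apply: (le_trans (ler_normD _ _)); rewrite lerD2l normrM (gtr0_norm th0).
  by rewrite ler_piMr.
have h2 th : 0 < th -> th <= 1 -> `|b + c * th| <= `|K| * th.
  move=> th0 th1; apply: (divth th) => //; apply: (divth th) => //.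
  have -> : (b + c * th) * th * th = a * th + b * th ^+ 2 + c * th ^+ 3.
    by rewrite a0; ring.
  have t43 : th ^+ 4 <= th ^+ 3 by apply: ler_wiXn2l => //; exact: ltW.
  apply: (le_trans (h _ th0 th1)); apply: (le_trans (ler_norm _)).
  rewrite normrM (ger0_norm (exprn_ge0 4 (ltW th0))) -!mulrA -expr2 -exprS.
  exact: ler_wpM2l.
have b0 : b = 0.
  apply: (@eq0_le_small b (`|K| + `|c|)) => th th0 th1.
  by apply: small (h2 _ th0 th1) _; first exact: ltW.
split=> //; apply: (@eq0_le_small c `|K|) => th th0 th1.
apply: (divth th) => //; apply: (divth th) => //; apply: (divth th) => //.
have -> : c * th * th * th = a * th + b * th ^+ 2 + c * th ^+ 3.
  by rewrite a0 b0; ring.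
apply: (le_trans (h _ th0 th1)); rewrite -!mulrA -expr2 -!exprS.
by apply: ler_wpM2r (ler_norm K); exact: exprn_ge0 (ltW th0).
Qed.

End taylor.

Section gaussian_moments.
Context {d : measure_display} {T : measurableType d} {R : realType}.
Variables (P : probability T R) (X : T -> R) (s : R).
Hypothesis s0 : 0 < s.
Hypothesis mX : measurable_fun setT X.
Hypothesis lawX : forall U, measurable U -> P (X @^-1` U) = normal_prob 0 s U.

Local Notation E X := (\int[P]_w X w)%R.

Lemma gaussian_mgf th :
  (\int[P]_w (expR (th * X w))%:E = (expR (th ^+ 2 * s ^+ 2 / 2))%:E)%E.
Proof.
pose X' : {mfun T >-> measurableTypeR R} :=
  HB.pack X (isMeasurableFun.Build _ _ _ (measurableTypeR R) _ mX).
have mf : measurable_fun setT (fun x : R => (expR (th * x))%:E).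
  by apply/measurable_EFinP; apply: measurableT_comp => //; exact: measurable_funM.
rewrite -mgf_normal_prob ?gt_eqF//.
transitivity (\int[distribution P X']_x (expR (th * x))%:E)%E.
  by rewrite ge0_integral_distribution// => x; rewrite lee_fin expR_ge0.
by apply: eq_measure_integral => U mU _; exact: lawX.
Qed.

Lemma integrable_gaussian_mgf th :
  P.-integrable setT (fun w => (expR (th * X w))%:E).
Proof.
apply/integrableP; split.
  by apply/measurable_EFinP; apply: measurableT_comp => //; exact: measurable_funM.
under eq_integral do rewrite gee0_abs ?lee_fin ?expR_ge0//.
by rewrite gaussian_mgf ltry.
Qed.

Lemma has_moments_gaussian : has_moments P X.
Proof. by apply: has_moments_mgf => //; exact: integrable_gaussian_mgf. Qed.

Lemma has_moments_expR_gaussian th : has_moments P (fun w => expR (th * X w)).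
Proof.
split; first by apply: measurableT_comp => //; exact: measurable_funM.
move=> n; have := integrable_gaussian_mgf (n%:R * th).
apply: eq_integrable => // w _.
by rewrite ger0_norm ?expR_ge0// -expRM_natl mulrA.
Qed.

Lemma expect_expR_gaussian th :
  E (fun w => expR (th * X w)) = expR (th ^+ 2 * s ^+ 2 / 2).
Proof. by rewrite /Rintegral gaussian_mgf. Qed.

(** Both the integrand [expR (th * X w)] and the known value [expR (th ^+ 2 * v)] are cubic
    polynomials in [th] up to an error of order [th ^+ 4], so their coefficients agree. *)
Lemma expect_gaussian_moments :
  [/\ E X = 0, E (fun w => X w ^+ 2) = s ^+ 2 & E (fun w => X w ^+ 3) = 0].
Proof.
have hX := has_moments_gaussian.
have hXn n : has_moments P (fun w => X w ^+ n) by exact: has_momentsX.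
have he := has_moments_expR_gaussian.
(* For 0 < [th] <= 1 the Taylor error of the integrand is at most [th ^+ 4] times this variable,
   since expR |th X| <= expR X + expR (- X). The other part of [K] comes from expanding
   [expR (th ^+ 2 * v)]. *)
pose C := E (fun w => X w ^+ 4 * (expR (1 * X w) + expR (-1 * X w))).
have hC : has_moments P (fun w => X w ^+ 4 * (expR (1 * X w) + expR (-1 * X w))).
  by apply: has_momentsM => //; exact: has_momentsD.
pose v := s ^+ 2 / 2.
have v0 : 0 <= v by rewrite divr_ge0// exprn_ge0// ltW.
pose K := C + (v ^+ 2 / 2 + v ^+ 3 / 6 + v ^+ 4 * expR v).
have [a0 b0 c0] : [/\ E X = 0, E (fun w => X w ^+ 2) / 2 - v = 0 &
    E (fun w => X w ^+ 3) / 6 = 0].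
  apply: (@cubic_coefs_eq0 _ _ _ _ K) => th th0 th1.
  pose q w := 1 + (th * X w + (th ^+ 2 / 2 * X w ^+ 2 + th ^+ 3 / 6 * X w ^+ 3)).
  have h3 : has_moments P (fun w => th ^+ 3 / 6 * X w ^+ 3) by exact: has_momentsZ.
  have h23 : has_moments P
      (fun w => th ^+ 2 / 2 * X w ^+ 2 + th ^+ 3 / 6 * X w ^+ 3).
    by apply: has_momentsD => //; exact: has_momentsZ.
  have h123 : has_moments P (fun w =>
      th * X w + (th ^+ 2 / 2 * X w ^+ 2 + th ^+ 3 / 6 * X w ^+ 3)).
    by apply: has_momentsD => //; exact: has_momentsZ.
  have hq : has_moments P q by apply: has_momentsD => //; exact: has_moments_cst.
  have Eq : E q = 1 + th * E X + th ^+ 2 / 2 * E (fun w => X w ^+ 2) +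
      th ^+ 3 / 6 * E (fun w => X w ^+ 3).
    rewrite /q expectD//; last exact: has_moments_cst.
    rewrite expect_cst expectD//; last exact: has_momentsZ.
    rewrite expectZ// expectD//; last exact: has_momentsZ.
    by rewrite !expectZ// !addrA.
  have Eeq : `|E (fun w => expR (th * X w)) - E q| <= th ^+ 4 * C.
    rewrite -expectB//; apply: (le_trans (le_normr_Rintegral measurableT _)).
      exact: has_moments_integrable (has_momentsB _ _ _ (he th) hq).
    rewrite -expectZ//; apply: expect_le => //.
    - split.
        apply: measurableT_comp => //.
        exact: has_moments_measurable (has_momentsB _ _ _ (he th) hq).
      move=> n; under eq_fun do rewrite normr_id.
      exact: (has_momentsB _ _ _ (he th) hq).2.
    - exact: has_momentsZ.
    - move=> w; have := expR_taylor3 (th * X w).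
      have -> : 1 + th * X w + (th * X w) ^+ 2 / 2 + (th * X w) ^+ 3 / 6 = q w.
        by rewrite /q; ring.
      move=> /le_trans; apply; rewrite exprMn -mulrA ler_wpM2l ?exprn_even_ge0//.
      rewrite ler_wpM2l ?exprn_even_ge0// mul1r mulN1r.
      apply: (@le_trans _ _ (expR `|X w|)).
        by rewrite ler_expR normrM ler_piMl// gtr0_norm.
      have := expR_ge0 (X w); have := expR_ge0 (- X w).
      by case: (ler0P (X w)) => _; lra.
  have tvE : th ^+ 2 * s ^+ 2 / 2 = th ^+ 2 * v by rewrite /v; field.
  have Ev := expR_taylor3 (th ^+ 2 * v).
  have tv0 : 0 <= th ^+ 2 * v by rewrite mulr_ge0// exprn_ge0// ltW.
  have tv : th ^+ 2 * v <= v by rewrite ler_piMl// exprn_ile1// ltW.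
  rewrite (ger0_norm tv0) in Ev.
  have evv : expR (th ^+ 2 * v) <= expR v by rewrite ler_expR.
  have {}Ev := le_trans Ev (ler_wpM2l (exprn_ge0 4 tv0) evv).
  move: Eeq; rewrite Eq expect_expR_gaussian tvE.
  move: Ev; rewrite !ler_norml /K.
  set Z := expR (th ^+ 2 * v).
  have t60 : th ^+ 6 <= th ^+ 4 by apply: ler_wiXn2l => //; exact: ltW.
  have t80 : th ^+ 8 <= th ^+ 4 by apply: ler_wiXn2l => //; exact: ltW.
  have t4 : 0 <= th ^+ 4 by rewrite exprn_ge0 ?ltW.
  have v3 : 0 <= v ^+ 3 / 6 by rewrite divr_ge0 ?exprn_ge0.
  have v4 : 0 <= v ^+ 4 * expR v by rewrite mulr_ge0 ?exprn_ge0 ?expR_ge0.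
  have e2 : (th ^+ 2 * v) ^+ 2 / 2 = th ^+ 4 * (v ^+ 2 / 2) by field.
  have e3 : (th ^+ 2 * v) ^+ 3 / 6 = th ^+ 6 * (v ^+ 3 / 6) by field.
  have e4 : (th ^+ 2 * v) ^+ 4 * expR v = th ^+ 8 * (v ^+ 4 * expR v) by ring.
  have l3 := ler_wpM2r v3 t60; have l4 := ler_wpM2r v4 t80.
  have g2 : 0 <= th ^+ 4 * (v ^+ 2 / 2) by rewrite mulr_ge0// divr_ge0// exprn_ge0.
  have g3 : 0 <= th ^+ 6 * (v ^+ 3 / 6) by rewrite mulr_ge0// exprn_ge0 ?ltW.
  rewrite e2 e3 e4 => /andP[A1 A2] /andP[B1 B2]; apply/andP; split.
  - rewrite mulrDl !mulrDl; lra.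
  - rewrite mulrDl !mulrDl; lra.
split=> //.
- move/eqP: b0; rewrite subr_eq0 => /eqP; rewrite /v => b0.
  by apply: (@mulIf _ 2^-1); rewrite ?invr_eq0 ?pnatr_eq0.
- by move/eqP: c0; rewrite mulf_eq0 invr_eq0 pnatr_eq0 orbF => /eqP.
Qed.

(** Exponents of size [s^-1] make the generating function equal to [expR 2^-1] whatever [s] is,
    which gives the scaling [s ^+ 4]; 48 is 4! times the two signs. *)
Lemma expect_gaussian4 :
  E (fun w => X w ^+ 4) <= 48 * expR 2^-1 * s ^+ 4.
Proof.
have he := has_moments_expR_gaussian; have hX := has_moments_gaussian.
have si : s^-1 ^+ 2 * s ^+ 2 / 2 = 2^-1.
  by rewrite -exprMn mulVf ?gt_eqF// expr1n mul1r.
have -> : 48 * expR 2^-1 * s ^+ 4 =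
    E (fun w => s ^+ 4 * 24 * (expR (s^-1 * X w) + expR (- s^-1 * X w))).
  rewrite expectZ; last exact: has_momentsD.
  by rewrite expectD// !expect_expR_gaussian sqrrN si; ring.
apply: expect_le; first exact: has_momentsX.
  by apply: has_momentsZ; exact: has_momentsD.
move=> w; have := exprn_le_expR (s^-1 * X w) 4.
rewrite -mulNr normrM exprMn normfV (gtr0_norm s0) -mulrA exprVn.
by rewrite ler_pdivrMl ?exprn_gt0// -normrX ger0_norm ?exprn_even_ge0.
Qed.

End gaussian_moments.

(** * The stopped walk *)

Section stopped_walk.
Context {R : realType}.
Implicit Types (y dl mu : R) (xi : nat -> R).

Definition positive_ind (s : R) : R := (0 < s)%R%:R.

Fixpoint stopped y xi (k : nat) : R :=
  if k is j.+1 then stopped y xi j + positive_ind (stopped y xi j) * xi j else y.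

Definition clock dl y xi (n : nat) : R :=
  dl * \sum_(j < n) positive_ind (stopped y xi j).

Definition area dl y xi (n : nat) : R :=
  dl * \sum_(j < n) positive_ind (stopped y xi j) * stopped y xi j.

Lemma positive_ind1 s : 0 < s -> positive_ind s = 1.
Proof. by rewrite /positive_ind => ->. Qed.

Lemma positive_ind0 s : s <= 0 -> positive_ind s = 0.
Proof. by rewrite /positive_ind leNgt => /negbTE ->. Qed.

Lemma positive_ind_ge0 s : 0 <= positive_ind s.
Proof. exact: ler0n. Qed.

Lemma positive_ind_le1 s : positive_ind s <= 1.
Proof. by rewrite /positive_ind lern1 leq_b1. Qed.

Lemma positive_indM_ge0 s : 0 <= positive_ind s * s.
Proof.
by have [s0|s0] := ltP 0 s; rewrite ?(positive_ind1 _ s0) ?(positive_ind0 _ s0);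
  rewrite ?mul1r ?mul0r// ltW.
Qed.

(** Nonpositive values are absorbing, so a positive value certifies that the walk has not been
    stopped and still equals the free one. *)
Lemma stopped_gt0 y xi k : 0 < stopped y xi k ->
  (forall j, (j <= k)%N -> 0 < stopped y xi j) /\
  stopped y xi k = y + \sum_(j < k) xi j.
Proof.
elim: k => [|k ih] /= Sk.
  by split; [case|rewrite big_ord0 addr0].
have S0 : 0 < stopped y xi k.
  have [//|s0] := ltP 0 (stopped y xi k).
  by move: Sk; rewrite positive_ind0// mul0r addr0 ltNge s0.
have [ih1 ih2] := ih S0; split.
  by move=> j; rewrite leq_eqVlt => /predU1P[->//|]; exact: ih1.
by rewrite positive_ind1// mul1r ih2 big_ord_recr /= addrA.
Qed.

Lemma stopped_alive y xi k :
  (forall j, (j <= k)%N -> 0 < y + \sum_(i < j) xi i) -> 0 < stopped y xi k.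
Proof.
elim: k => [|k ih] h; first by have := h 0%N isT; rewrite big_ord0 addr0.
have S0 : 0 < stopped y xi k by apply: ih => j jk; apply: h; exact: leqW.
have [_ e] := stopped_gt0 _ _ _ S0.
rewrite /= positive_ind1// mul1r e.
by have := h k.+1 (leqnn _); rewrite big_ord_recr /= addrA.
Qed.

(* Once the walk is nonpositive it has just jumped there, so the overshoot is at
   most the size of one of the increments. *)
Lemma overshoot_le y xi k : 0 <= y -> stopped y xi k <= 0 ->
  stopped y xi k ^+ 4 <= \sum_(j < k) xi j ^+ 4.
Proof.
move=> y0; elim: k => [|k ih] /= Sk.
  by have -> : y = 0 by [apply/le_anti/andP]; rewrite expr0n big_ord0.
move: Sk; rewrite big_ord_recr /=; have [S0|S0] := ltP 0 (stopped y xi k).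
- rewrite positive_ind1// mul1r => Sx; apply: (@le_trans _ _ (xi k ^+ 4)).
    rewrite -(ger0_norm (exprn_even_ge0 (xi k) (isT : ~~ odd 4))).
    rewrite -(ger0_norm (exprn_even_ge0 (_ + _) (isT : ~~ odd 4))) !normrX.
    rewrite lerXn2r ?nnegrE// (ler0_norm Sx) ler0_norm; lra.
  by rewrite lerDr sumr_ge0// => j _; rewrite exprn_even_ge0.
- rewrite positive_ind0// mul0r addr0 => _; apply: (le_trans (ih S0)).
  by rewrite lerDl exprn_even_ge0.
Qed.

Lemma clock_ge0 dl y xi n : 0 <= dl -> 0 <= clock dl y xi n.
Proof.
by move=> dl0; rewrite mulr_ge0// sumr_ge0// => j _; exact: positive_ind_ge0.
Qed.

Lemma clock_le dl y xi n : 0 <= dl -> clock dl y xi n <= n%:R * dl.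
Proof.
move=> dl0; rewrite [leRHS]mulrC; apply: ler_wpM2l => //.
rewrite -[n in leRHS]card_ord -sumr_const; apply: ler_sum => j _.
exact: positive_ind_le1.
Qed.

Lemma area_ge0 dl y xi n : 0 <= dl -> 0 <= area dl y xi n.
Proof.
by move=> dl0; rewrite mulr_ge0// sumr_ge0// => j _; exact: positive_indM_ge0.
Qed.

Lemma sqr_sum_le (x : nat -> R) n :
  (\sum_(j < n) x j) ^+ 2 <= n%:R * \sum_(j < n) x j ^+ 2.
Proof.
elim: n => [|n ih]; first by rewrite !big_ord0 expr0n mul0r.
rewrite !big_ord_recr /=; set A := \sum_(i < n) _ in ih *.
set B := \sum_(i < n) _ in ih *; rewrite -natr1.
case: n @A @B ih => [|n] A B ih.
  by rewrite /A /B !big_ord0 !add0r mul1r.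
have n0 : 0 < n.+1%:R :> R by rewrite ltr0n.
have h : 2 * A * x n.+1 <= B + n.+1%:R * x n.+1 ^+ 2.
  rewrite -(ler_pM2l n0).
  have := sqr_ge0 (A - n.+1%:R * x n.+1); nra.
nra.
Qed.

Definition mean_area dl mu (s : R) := s ^+ 2 / (2 * mu) + ((2 * mu ^+ 2)^-1 + dl / 2) * s.

Definition mean_product dl mu (s : R) :=
  s ^+ 3 / (2 * mu ^+ 2) + (mu ^- 3 + dl / (2 * mu)) * s ^+ 2 + s / mu ^+ 4.

(* [s / mu], [mean_area] and [mean_product] are the exact mean clock, mean area
   and mean product of the walk with Gaussian steps of mean [- mu * dl] and
   variance [dl], if the overshoot is neglected. *)
Definition remainder dl mu t a s :=
  t * mean_area dl mu s + a * (s / mu) + mean_product dl mu s.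

Definition compensated dl mu y xi n :=
  clock dl y xi n * area dl y xi n +
  remainder dl mu (clock dl y xi n) (area dl y xi n) (stopped y xi n).

(** With [quadratic_coef], the coefficients of [D k] and [D k ^+ 2 - dl] when [compensated] is
    expanded over a live step. Both are polynomials in the state before the step, hence independent
    of [D k]. *)
Definition linear_coef dl mu t a s := (t + dl) * ((s - mu * dl) / mu + (2 * mu ^+ 2)^-1 + dl / 2)
  + (a + dl * s) / mu + 3 * (s - mu * dl) ^+ 2 / (2 * mu ^+ 2)
  + 2 * (mu ^- 3 + dl / (2 * mu)) * (s - mu * dl) + mu ^- 4.

Definition quadratic_coef dl mu t s := (t + dl) / (2 * mu) + 3 * (s - mu * dl) / (2 * mu ^+ 2)
  + (mu ^- 3 + dl / (2 * mu)).

(** The expansion has no constant term: this is what determines the corrections of order [dl] in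
    [mean_area] and [mean_product]. The factors [D k], [D k ^+ 2 - dl] and [D k ^+ 3] all have mean
    zero for a centred Gaussian increment of variance [dl]. *)
Lemma compensatedS dl mu y (D : nat -> R) k : mu != 0 ->
  let xi j := D j - mu * dl in
  let t := clock dl y xi k in let a := area dl y xi k in
  let s := stopped y xi k in let b := positive_ind s in
  compensated dl mu y xi k.+1 = compensated dl mu y xi k +
  (b * linear_coef dl mu t a s * D k +
   b * quadratic_coef dl mu t s * (D k ^+ 2 - dl) +
   b * (2 * mu ^+ 2)^-1 * D k ^+ 3).
Proof.
move=> mu0 xi t a s b.
have -> : compensated dl mu y xi k.+1 = (t + dl * b) * (a + dl * (b * s)) +
    remainder dl mu (t + dl * b) (a + dl * (b * s)) (s + b * xi k).
  by rewrite /compensated /t /a /clock /area !big_ord_recr /= !mulrDr.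
rewrite /compensated -/t -/a -/s /remainder /mean_area /mean_product.
rewrite /linear_coef /quadratic_coef /xi /b.
have [s0|s0] := ltP 0 s; first by rewrite positive_ind1//; field.
by rewrite positive_ind0//; field.
Qed.

(** A pathwise bound in quantities whose means are computable: [u] controls an overshoot, [z] a walk
    still alive. The free parameter [eps] balances them against the unbounded factor [a]. *)
Lemma remainder_le dl mu t a s H eps u z : 0 < mu -> 0 < dl -> dl <= 1 ->
  0 <= t -> t <= H -> 1 <= H -> 0 <= a -> 0 < eps -> eps <= 1 ->
  (s <= 0 -> s ^+ 4 <= u) -> 0 <= u -> (0 < s -> expR (mu * s) <= z) -> 0 <= z ->
  `|remainder dl mu t a s| <=
    ((2 * mu)^-1 + ((2 * mu ^+ 2)^-1 + 2^-1) + mu^-1 + (2 * mu ^+ 2)^-1 +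
      (mu ^- 3 + (2 * mu)^-1) + mu ^- 4) * H *
    (eps + u / eps ^+ 3 + (mu^-1 + 2 / mu ^+ 2 + 6 / mu ^+ 3) * z / eps) +
    eps * a ^+ 2 / mu.
Proof.
move=> mu0 dl0 dl1 t0 tH H1 a0 e0 e1 su u0 sz z0.
set C := mu^-1 + 2 / mu ^+ 2 + 6 / mu ^+ 3.
set Q := eps + u / eps ^+ 3 + C * z / eps.
have p1 : 0 < mu^-1 by rewrite invr_gt0.
have p2 : 0 < (2 * mu ^+ 2)^-1 by rewrite invr_gt0 mulr_gt0// exprn_gt0.
have p3 : 0 < mu ^- 3 by rewrite invr_gt0 exprn_gt0.
have p4 : 0 < mu ^- 4 by rewrite invr_gt0 exprn_gt0.
have p5 : 0 < (2 * mu)^-1 by rewrite invr_gt0 mulr_gt0.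
have p22 : 0 < 2 / mu ^+ 2 by rewrite divr_gt0// exprn_gt0.
have p63 : 0 < 6 / mu ^+ 3 by rewrite divr_gt0// exprn_gt0.
have C0 : 0 <= C by rewrite /C; lra.
have ei : 1 <= eps^-1 by rewrite invf_ge1.
have Cz0 : 0 <= C * z by rewrite mulr_ge0.
have ue0 : 0 <= u / eps ^+ 3 by rewrite divr_ge0// exprn_ge0// ltW.
have b0 := normr_ge0 s.
set b := `|s| in b0 *.
(* An overshoot below [eps] is covered by the term [eps] of [Q]. A larger one satisfies b / eps >=
   1, so factors b / eps and 1 / eps may be inserted until b ^ 4 / eps ^ 3 appears. *)
have [hb1 hb2 hb3 hb4] : [/\ b <= Q, b ^+ 2 <= Q, b ^+ 3 <= Q & b ^+ 2 / eps <= Q].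
  have [s0|s0] := leP s 0.
  - have b4 : b ^+ 4 <= u.
      by rewrite /b -normrX ger0_norm ?exprn_even_ge0// su.
    have Cze : 0 <= C * z / eps by rewrite divr_ge0// ltW.
    have [be|eb] := leP b eps.
    + have be2 : b ^+ 2 / eps <= eps.
        by rewrite ler_pdivrMr// -expr2 lerXn2r ?nnegrE// ltW.
      have bb : b <= 1 by exact: le_trans e1.
      have : b ^+ 2 <= b by rewrite expr2 ler_piMl.
      have : b ^+ 3 <= b by rewrite exprS ler_piMr// exprn_ile1.
      by rewrite /Q; split; lra.
    + have eb' : 1 <= b / eps by rewrite ler_pdivlMr// mul1r ltW.
      have k3 : b ^+ 4 / eps ^+ 3 <= u / eps ^+ 3.
        by rewrite ler_wpM2r// invr_ge0 exprn_ge0// ltW.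
      have be0 : b != 0 by rewrite gt_eqF// (lt_trans e0).
      have r1 : b <= b ^+ 4 / eps ^+ 3.
        have -> : b ^+ 4 / eps ^+ 3 = b * (b / eps) ^+ 3 by field; rewrite gt_eqF.
        by rewrite ler_peMr// exprn_ege1.
      have r4 : b ^+ 2 / eps <= b ^+ 4 / eps ^+ 3.
        have -> : b ^+ 4 / eps ^+ 3 = b ^+ 2 / eps * (b / eps) ^+ 2.
          by field; rewrite gt_eqF.
        by rewrite ler_peMr ?exprn_ege1// divr_ge0 ?exprn_ge0// ltW.
      have r2 : b ^+ 2 <= b ^+ 2 / eps by rewrite ler_peMr// exprn_ge0.
      have r3 : b ^+ 3 <= b ^+ 4 / eps ^+ 3.
        have -> : b ^+ 4 / eps ^+ 3 = b ^+ 3 * (b / eps * (eps^-1 * eps^-1)).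
          by field; rewrite gt_eqF.
        by rewrite ler_peMr ?exprn_ge0// mulr_ege1// mulr_ege1.
      by rewrite /Q; split; lra.
  - have bs : b = s by rewrite /b gtr0_norm.
    have ms0 : 0 <= mu * s by rewrite mulr_ge0 ?ltW.
    have hz := sz s0.
    have Czz : C * z <= C * z / eps by rewrite ler_peMr.
    (* One term of the exponential series at mu s; [C] collects the constants n! / mu ^ n for n = 1,
       2, 3. *)
    have ex n : s ^+ n.+1 <= n.+1`!%:R / mu ^+ n.+1 * z.
      have := expR_ge1Dxn n ms0; rewrite exprMn => h.
      rewrite -ler_pdivrMl ?divr_gt0 ?ltr0n ?fact_gt0 ?exprn_gt0//.
      apply: le_trans hz; apply: le_trans h.
      rewrite invf_div -mulrAC -mulrA mulrC -mulrA; lra.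
    have x1 := ex 0%N; have x2 := ex 1%N; have x3 := ex 2%N.
    rewrite !factS fact0 !expr1 in x1 x2 x3.
    have y1 : b <= C * z.
      rewrite bs (le_trans x1)// ler_wpM2r// /C; lra.
    have y2 : b ^+ 2 <= C * z.
      rewrite bs (le_trans x2)// ler_wpM2r// /C; lra.
    have y3 : b ^+ 3 <= C * z.
      rewrite bs (le_trans x3)// ler_wpM2r// /C; lra.
    have y4 : b ^+ 2 / eps <= C * z / eps by rewrite ler_wpM2r// invr_ge0 ltW.
    by rewrite /Q; split; lra.
have Q0 : 0 <= Q := le_trans b0 hb1.
(* Young's inequality: the area has no deterministic bound, so it is kept only as [eps * a ^+ 2],
   whose mean is controlled later. *)
have hab : a * b <= eps * a ^+ 2 + Q.
  have : 0 <= (eps * a - b) ^+ 2 / eps by rewrite divr_ge0 ?sqr_ge0// ltW.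
  have -> : (eps * a - b) ^+ 2 / eps = eps * a ^+ 2 - 2 * (a * b) + b ^+ 2 / eps.
    by field; rewrite gt_eqF.
  have : 0 <= a * b by rewrite mulr_ge0.
  lra.
have HQ : Q <= H * Q by rewrite ler_peMl.
have nrm : `|remainder dl mu t a s| <= t * (b ^+ 2 / (2 * mu) +
    ((2 * mu ^+ 2)^-1 + dl / 2) * b) + a * b / mu +
    (b ^+ 3 / (2 * mu ^+ 2) + (mu ^- 3 + dl / (2 * mu)) * b ^+ 2 + b / mu ^+ 4).
  have q1 : 0 <= (2 * mu ^+ 2)^-1 + dl / 2 by lra.
  have q2 : 0 <= mu ^- 3 + dl / (2 * mu) by rewrite addr_ge0 ?divr_ge0 ?mulr_ge0 ?ltW.
  rewrite /remainder /mean_area /mean_product.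
  apply: (le_trans (ler_normD _ _)); apply: lerD.
    apply: (le_trans (ler_normD _ _)); apply: lerD.
  - rewrite normrM (ger0_norm t0) ler_wpM2l//.
    apply: (le_trans (ler_normD _ _)); apply: lerD.
      by rewrite normrM normrX [`|(2 * mu)^-1|]gtr0_norm.
    by rewrite normrM (ger0_norm q1).
  - by rewrite !normrM (ger0_norm a0) [`|mu^-1|]gtr0_norm// mulrA.
  - apply: (le_trans (ler_normD _ _)); apply: lerD.
      apply: (le_trans (ler_normD _ _)); apply: lerD.
    + by rewrite normrM normrX [`|(2 * mu ^+ 2)^-1|]gtr0_norm.
    + by rewrite normrM (ger0_norm q2) normrX.
    + by rewrite normrM [`|mu ^- 4|]gtr0_norm.
apply: (le_trans nrm).
have dl5 : dl / (2 * mu) <= (2 * mu)^-1 by rewrite ler_piMl// ltW.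
have T1 : t * (b ^+ 2 / (2 * mu) + ((2 * mu ^+ 2)^-1 + dl / 2) * b) <=
    H * ((2 * mu)^-1 * Q + ((2 * mu ^+ 2)^-1 + 2^-1) * Q).
  apply: ler_pM => //; first by rewrite addr_ge0 ?mulr_ge0 ?exprn_ge0// ?ltW//; lra.
  apply: lerD; first by rewrite mulrC ler_wpM2l// ltW.
  apply: ler_pM => //; lra.
have T2 : a * b / mu <= eps * a ^+ 2 / mu + mu^-1 * Q.
  by rewrite [mu^-1 * Q]mulrC -mulrDl ler_wpM2r// ltW.
have T3 : b ^+ 3 / (2 * mu ^+ 2) <= (2 * mu ^+ 2)^-1 * Q.
  by rewrite mulrC ler_wpM2l// ltW.
have T4 : (mu ^- 3 + dl / (2 * mu)) * b ^+ 2 <= (mu ^- 3 + (2 * mu)^-1) * Q.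
  by apply: ler_pM; rewrite ?exprn_ge0 ?lerD2l// addr_ge0 ?divr_ge0 ?mulr_ge0 ?ltW.
have T5 : b / mu ^+ 4 <= mu ^- 4 * Q by rewrite mulrC ler_wpM2l// ltW.
have m2 := ler_wpM2l (ltW p1) HQ; have m3 := ler_wpM2l (ltW p2) HQ.
have m4 : (mu ^- 3 + (2 * mu)^-1) * Q <= (mu ^- 3 + (2 * mu)^-1) * (H * Q).
  by rewrite ler_wpM2l// addr_ge0// ltW.
have m5 := ler_wpM2l (ltW p4) HQ.
set X := _ * H * Q.
have -> : X = H * ((2 * mu)^-1 * Q + ((2 * mu ^+ 2)^-1 + 2^-1) * Q) +
    (mu^-1 * (H * Q) + (2 * mu ^+ 2)^-1 * (H * Q) +
     (mu ^- 3 + (2 * mu)^-1) * (H * Q) + mu ^- 4 * (H * Q)).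
  by rewrite /X; ring.
lra.
Qed.

End stopped_walk.

(** * Moments and error bound of the Gaussian walk *)

Section gaussian_walk.
Context {d : measure_display} {T : measurableType d} {R : realType}.
Variables (P : probability T R) (D : nat -> T -> R) (dl mu y : R).
Hypotheses (dl0 : 0 < dl) (dl1 : dl <= 1) (mu0 : 0 < mu) (y0 : 0 <= y).
Hypothesis mD : forall k, measurable_fun setT (D k).
Hypothesis lawD : forall k U, measurable U ->
  P (D k @^-1` U) = normal_prob 0 (Num.sqrt dl) U.
Hypothesis indepD : forall n (U : nat -> set R), (forall i, measurable (U i)) ->
  P (\bigcap_(i in `I_n) D i @^-1` U i) = (\prod_(i < n) P (D i @^-1` U i))%E.
Hypothesis lawW : forall k U, (0 < k)%N -> measurable U ->
  P ((fun w => \sum_(j < k) D j w) @^-1` U) =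
  normal_prob 0 (Num.sqrt (k%:R * dl)) U.

Local Notation E X := (\int[P]_w X w)%R.
Local Notation xi := (fun (w : T) (j : nat) => D j w - mu * dl).
Local Notation S k := (fun w => stopped y (xi w) k).
Local Notation clk k := (fun w => clock dl y (xi w) k).
Local Notation are k := (fun w => area dl y (xi w) k).

(** A pi-system generating the past of step [k]; on it, independence of the increments is just the
    product formula. *)
Definition cylinder (k : nat) : set (set T) := [set A | exists2 U : nat -> set R,
  (forall i, measurable (U i)) & A = \bigcap_(i in `I_k) D i @^-1` U i].

Lemma cylinder_setI k : setI_closed (cylinder k).
Proof.
move=> _ _ [U mU ->] [V mV ->]; exists (fun i => U i `&` V i).
  by move=> i; exact: measurableI.
by rewrite -bigcapI.
Qed.

Lemma cylinder_setT k : cylinder k setT.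
Proof.
by exists (fun=> setT) => //; apply/seteqP; split.
Qed.

Lemma cylinder_measurable k : cylinder k `<=` measurable.
Proof.
move=> _ [U mU ->]; apply: bigcap_measurableType => i _.
by rewrite -[X in measurable X]setTI; exact: mD.
Qed.

Lemma cylinder_indep k A V : cylinder k A -> measurable V ->
  P (A `&` D k @^-1` V) = (P A * P (D k @^-1` V))%E.
Proof.
move=> [U mU ->] mV.
pose U' i := if (i < k)%N then U i else V.
have mU' i : measurable (U' i) by rewrite /U'; case: ifP.
have -> : \bigcap_(i in `I_k) D i @^-1` U i `&` D k @^-1` V =
    \bigcap_(i in `I_k.+1) D i @^-1` U' i.
  apply/seteqP; split => [w [h1 h2] i|w h].
    rewrite /= ltnS leq_eqVlt => /predU1P[->|ik]; first by rewrite /U' ltnn.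
    by rewrite /U' ik; exact: h1.
  split; last by have := h k (ltnSn k); rewrite /U' ltnn.
  by move=> i /= ik; have := h i (leqW ik); rewrite /U' ik.
rewrite !indepD// big_ord_recr /= {2}/U' ltnn; congr (_ * _)%E.
by apply: eq_bigr => i _; rewrite /U' ltn_ord.
Qed.

Lemma measurable_for_D k j : (j < k)%N -> measurable_for (cylinder k) (D j).
Proof.
move=> jk _ V mV; rewrite setTI; apply: sub_sigma_algebra.
exists (fun i => if i == j then V else setT); first by move=> i; case: ifP.
apply/seteqP; split => [w Vw i _|w /(_ j jk)]; last by rewrite /= eqxx.
by rewrite /preimage /=; case: eqP => // ->.
Qed.

Lemma measurable_positive_ind : measurable_fun setT (@positive_ind R).
Proof.
rewrite (_ : @positive_ind R = \1_`]0, +oo[).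
  exact: measurable_indic.
by apply/funext => x; rewrite /positive_ind indicE mem_setE in_itv /= andbT.
Qed.

Lemma measurable_for_stopped k j : (j <= k)%N ->
  measurable_for (cylinder k) (S j).
Proof.
elim: j => [|j ih] jk; first exact: measurable_cst.
have mj := ih (ltnW jk).
apply: measurable_funD => //; apply: measurable_funM.
  by apply: measurableT_comp => //; exact: measurable_positive_ind.
by apply: measurable_funB; [exact: measurable_for_D|exact: measurable_cst].
Qed.

Lemma measurable_for_clock k : measurable_for (cylinder k) (clk k).
Proof.
apply: measurable_funM; first exact: measurable_cst.
apply: measurable_sum => j; apply: measurableT_comp.
  exact: measurable_positive_ind.
by apply: measurable_for_stopped; exact: ltnW.
Qed.

Lemma measurable_for_area k : measurable_for (cylinder k) (are k).
Proof.
apply: measurable_funM; first exact: measurable_cst.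
apply: measurable_sum => j; have mj := measurable_for_stopped _ _ (ltnW (ltn_ord j)).
by apply: measurable_funM => //; apply: measurableT_comp mj; exact: measurable_positive_ind.
Qed.

Lemma sqrt_dl_gt0 : 0 < Num.sqrt dl.
Proof. by rewrite sqrtr_gt0. Qed.

Lemma has_moments_D k : has_moments P (D k).
Proof. exact: has_moments_gaussian sqrt_dl_gt0 (mD k) (lawD k). Qed.

Lemma has_moments_xi k : has_moments P (fun w => xi w k).
Proof. by apply: has_momentsB; [exact: has_moments_D|exact: has_moments_cst]. Qed.

Lemma has_moments_positive_ind X : measurable_fun setT X ->
  has_moments P (fun w => positive_ind (X w)).
Proof.
move=> mX; apply: (has_moments_le _ _ (fun=> 1)) => [||w].
- by apply: measurableT_comp mX; exact: measurable_positive_ind.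
- exact: has_moments_cst.
- by rewrite normr1 ger0_norm ?positive_ind_le1 ?positive_ind_ge0.
Qed.

Lemma measurable_stopped k : measurable_fun setT (S k).
Proof.
apply: measurable_for_measurable (measurable_for_stopped k k (leqnn k)).
exact: cylinder_measurable.
Qed.

Lemma has_moments_stopped k : has_moments P (S k).
Proof.
elim: k => [|k ih]; first exact: has_moments_cst.
apply: has_momentsD => //; apply: has_momentsM; last exact: has_moments_xi.
by apply: has_moments_positive_ind; exact: measurable_stopped.
Qed.

Lemma has_moments_clock k : has_moments P (clk k).
Proof.
apply: has_momentsZ; apply: (has_moments_sum P k (fun j w => positive_ind (S j w))).
by move=> j; apply: has_moments_positive_ind; exact: measurable_stopped.
Qed.

Lemma has_moments_posM k : has_moments P (fun w => positive_ind (S k w) * S k w).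
Proof.
apply: has_momentsM; last exact: has_moments_stopped.
by apply: has_moments_positive_ind; exact: measurable_stopped.
Qed.

Lemma has_moments_area k : has_moments P (are k).
Proof.
apply: has_momentsZ.
apply: (has_moments_sum P k (fun j w => positive_ind (S j w) * S j w)).
exact: has_moments_posM.
Qed.

Lemma has_moments_remainder k :
  has_moments P (fun w => remainder dl mu (clk k w) (are k w) (S k w)).
Proof.
have hS := has_moments_stopped k; have ha := has_moments_area k.
have ht := has_moments_clock k.
rewrite /remainder /mean_area /mean_product.
repeat first [exact: hS | exact: ha | exact: ht | exact: has_moments_cst
  | exact: has_momentsX | apply: has_momentsD | apply: has_momentsM].
Qed.

Lemma has_moments_compensated k :
  has_moments P (fun w => compensated dl mu y (xi w) k).
Proof.
apply: has_momentsD; last exact: has_moments_remainder.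
by apply: has_momentsM; [exact: has_moments_clock|exact: has_moments_area].
Qed.

Lemma expect_adapted_D k (C : T -> R) (f : R -> R) :
  measurable_for (cylinder k) C -> has_moments P C -> measurable_fun setT f ->
  has_moments P (f \o D k) -> E (fun w => C w * f (D k w)) = E C * E (fun w => f (D k w)).
Proof.
move=> mC hC mf hf; apply: (pi_independent_expectM P (cylinder k)) => //.
- exact: cylinder_setI.
- exact: cylinder_setT.
- exact: cylinder_measurable.
- by move=> A V; exact: cylinder_indep.
Qed.

(** The martingale property in mean: in each term of [compensatedS] an adapted coefficient
    multiplies a centred function of the fresh increment. *)
Lemma expect_compensated n :
  E (fun w => compensated dl mu y (xi w) n) = mean_product dl mu y.
Proof.
elim: n => [|n ih].
  under eq_Rintegral do rewrite /compensated /remainder /clock /area !big_ord0 /=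
    !mulr0 !mul0r !add0r.
  exact: expect_cst.
have hD := has_moments_D n; have [D1 D2 D3] := expect_gaussian_moments _ _ _ sqrt_dl_gt0 (mD n) (lawD n).
have mS := measurable_for_stopped n n (leqnn n).
have mc := measurable_for_clock n; have ma := measurable_for_area n.
have hS := has_moments_stopped n; have hc := has_moments_clock n.
have ha := has_moments_area n.
have mb : measurable_for (cylinder n) (fun w => positive_ind (S n w)).
  by apply: measurableT_comp mS; exact: measurable_positive_ind.
have hb : has_moments P (fun w => positive_ind (S n w)).
  by apply: has_moments_positive_ind; exact: measurable_stopped.
pose c1 w := positive_ind (S n w) * linear_coef dl mu (clk n w) (are n w) (S n w).
pose c2 w := positive_ind (S n w) * quadratic_coef dl mu (clk n w) (S n w).
pose c3 w := positive_ind (S n w) * (2 * mu ^+ 2)^-1.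
have hc1 : has_moments P c1.
  rewrite /c1 /linear_coef.
  repeat first [exact: hS | exact: ha | exact: hc | exact: hb
    | exact: has_moments_cst
    | apply: has_momentsX | apply: has_momentsD | apply: has_momentsM].
have hc2 : has_moments P c2.
  rewrite /c2 /quadratic_coef.
  repeat first [exact: hS | exact: ha | exact: hc | exact: hb
    | exact: has_moments_cst
    | apply: has_momentsX | apply: has_momentsD | apply: has_momentsM].
have hc3 : has_moments P c3 by apply: has_momentsM => //; exact: has_moments_cst.
have mc1 : measurable_for (cylinder n) c1.
  rewrite /c1 /linear_coef.
  repeat first [exact: mS | exact: ma | exact: mc | exact: mb
    | exact: measurable_cst
    | apply: measurable_funX | apply: measurable_funD | apply: measurable_funM].
have mc2 : measurable_for (cylinder n) c2.
  rewrite /c2 /quadratic_coef.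
  repeat first [exact: mS | exact: ma | exact: mc | exact: mb
    | exact: measurable_cst
    | apply: measurable_funX | apply: measurable_funD | apply: measurable_funM].
have mc3 : measurable_for (cylinder n) c3.
  by apply: measurable_funM => //; exact: measurable_cst.
have hD2 : has_moments P (fun w => D n w ^+ 2 - dl).
  by apply: has_momentsB; [exact: has_momentsX|exact: has_moments_cst].
have hD3 : has_moments P (fun w => D n w ^+ 3) by exact: has_momentsX.
have e1 : E (fun w => c1 w * D n w) = 0.
  by rewrite (expect_adapted_D n c1 id)// D1 mulr0.
have e2 : E (fun w => c2 w * (D n w ^+ 2 - dl)) = 0.
  rewrite (expect_adapted_D n c2 (fun x => x ^+ 2 - dl))//; last first.
    by apply: measurable_funB => //; exact: measurable_funX.
  rewrite expectB; [|exact: has_momentsX|exact: has_moments_cst].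
  by rewrite expect_cst D2 sqr_sqrtr ?ltW// subrr mulr0.
have e3 : E (fun w => c3 w * D n w ^+ 3) = 0.
  by rewrite (expect_adapted_D n c3 (fun x => x ^+ 3))// D3 mulr0.
have h1 := has_momentsM _ _ _ hc1 hD; have h2 := has_momentsM _ _ _ hc2 hD2.
have h3 := has_momentsM _ _ _ hc3 hD3.
have h12 := has_momentsD _ _ _ h1 h2.
transitivity (E (fun w => compensated dl mu y (xi w) n +
    (c1 w * D n w + c2 w * (D n w ^+ 2 - dl) + c3 w * D n w ^+ 3))).
  apply: eq_Rintegral => w _.
  exact: (compensatedS dl mu y (fun j => D j w) n (lt0r_neq0 mu0)).
rewrite expectD; [|exact: has_moments_compensated|exact: has_momentsD].
rewrite ih expectD// expectD// e1 e2 e3; ring.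
Qed.

Let W k := fun w => \sum_(j < k) D j w.

Lemma has_moments_W k : has_moments P (W k).
Proof. by apply: has_moments_sum; exact: has_moments_D. Qed.

Lemma sumxi w k : \sum_(j < k) xi w j = W k w - mu * (k%:R * dl).
Proof. by rewrite sumrB sumr_const card_ord /W -mulr_natl; ring. Qed.

Lemma expect_W2 k : E (fun w => W k w ^+ 2) = k%:R * dl.
Proof.
case: k => [|k].
  under eq_Rintegral do rewrite /W big_ord0 expr0n.
  by rewrite expect_cst mul0r.
have k0 : 0 < k.+1%:R * dl by rewrite mulr_gt0.
have sk0 : 0 < Num.sqrt (k.+1%:R * dl) by rewrite sqrtr_gt0.
have mW : measurable_fun setT (W k.+1) := has_moments_measurable _ _ (has_moments_W _).
have lW U : measurable U -> P (W k.+1 @^-1` U) = normal_prob 0 (Num.sqrt (k.+1%:R * dl)) U.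
  exact: lawW.
have [_ -> _] := expect_gaussian_moments _ _ _ sk0 mW lW.
by rewrite sqr_sqrtr// ltW.
Qed.

(** While alive, the walk lies between 0 and [y + W j], because the drift is downward. Stopping can
    thus be forgotten, and Cauchy-Schwarz leaves second moments of Gaussian sums. *)
Lemma area2_le n w : are n w ^+ 2 <= dl ^+ 2 * n%:R * \sum_(j < n) (2 * y ^+ 2 + 2 * W j w ^+ 2).
Proof.
rewrite /area exprMn -mulrA ler_wpM2l ?exprn_ge0 ?(ltW dl0)//.
apply: (le_trans (sqr_sum_le (fun j => positive_ind (S j w) * S j w) n)).
rewrite ler_wpM2l//; apply: ler_sum => j _.
have [s0|s0] := ltP 0 (S j w); last first.
  rewrite positive_ind0// mul0r expr0n/=.
  by have := sqr_ge0 y; have := sqr_ge0 (W j w); lra.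
have [_ e] := stopped_gt0 _ _ _ s0; rewrite positive_ind1// mul1r.
have q0 : 0 <= mu * (j%:R * dl) by rewrite mulr_ge0 ?mulr_ge0 ?(ltW mu0) ?(ltW dl0).
move: s0; rewrite /= e sumxi => s0.
have h1 : y + (W j w - mu * (j%:R * dl)) <= y + W j w by lra.
have h2 : (y + (W j w - mu * (j%:R * dl))) ^+ 2 <= (y + W j w) ^+ 2.
  by rewrite lerXn2r ?nnegrE// ltW// (lt_le_trans s0).
apply: (le_trans h2); have := sqr_ge0 (y - W j w); nra.
Qed.

Lemma expect_area2 n : E (fun w => are n w ^+ 2) <=
  (n%:R * dl) ^+ 2 * (2 * y ^+ 2 + 2 * (n%:R * dl)).
Proof.
have hW j : has_moments P (fun w => 2 * y ^+ 2 + 2 * W j w ^+ 2).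
  apply: has_momentsD; first exact: has_moments_cst.
  by apply: has_momentsZ; apply: has_momentsX; exact: has_moments_W.
have hs := has_moments_sum P n _ hW.
apply: (@le_trans _ _ (E (fun w => dl ^+ 2 * n%:R *
    \sum_(j < n) (2 * y ^+ 2 + 2 * W j w ^+ 2)))).
  apply: expect_le; first exact: has_momentsX (has_moments_area n).
    exact: has_momentsZ.
  exact: area2_le.
rewrite expectZ// (expect_sum P n (fun j w => 2 * y ^+ 2 + 2 * W j w ^+ 2))//.
rewrite (_ : (n%:R * dl) ^+ 2 * _ = dl ^+ 2 * n%:R *
  (\sum_(j < n) (2 * y ^+ 2 + 2 * (n%:R * dl)))); last first.
  by rewrite sumr_const card_ord -mulr_natl; ring.
rewrite ler_wpM2l ?mulr_ge0 ?exprn_ge0 ?(ltW dl0)//; apply: ler_sum => j _.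
rewrite expectD; last 2 first.
- exact: has_moments_cst.
- by apply: has_momentsZ; apply: has_momentsX; exact: has_moments_W.
rewrite expect_cst expectZ; last by apply: has_momentsX; exact: has_moments_W.
by rewrite expect_W2 lerD2l ler_wpM2l// ler_wpM2r ?(ltW dl0)// ler_nat ltnW.
Qed.

Lemma expect_prod2 n : E (fun w => (clk n w * are n w) ^+ 2) <=
  (n%:R * dl) ^+ 4 * (2 * y ^+ 2 + 2 * (n%:R * dl)).
Proof.
have ha2 : has_moments P (fun w => are n w ^+ 2) by exact: has_momentsX (has_moments_area n).
apply: (@le_trans _ _ (E (fun w => (n%:R * dl) ^+ 2 * are n w ^+ 2))).
  apply: expect_le.
  - by apply: has_momentsX; apply: has_momentsM; [exact: has_moments_clock|exact: has_moments_area].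
  - exact: has_momentsZ.
  - move=> w; have c0 := clock_ge0 dl y (xi w) n (ltW dl0).
    have c1 := clock_le dl y (xi w) n (ltW dl0).
    rewrite exprMn ler_wpM2r ?sqr_ge0// lerXn2r ?nnegrE//.
    exact: le_trans c1.
rewrite expectZ// (_ : 4%N = (2 + 2)%N)// exprD -mulrA ler_wpM2l ?sqr_ge0//.
exact: expect_area2.
Qed.

(** The order [dl ^+ 2] per step is the point: summed over H / dl steps it gives H dl, which
    vanishes with the mesh. The drift part [(mu * dl) ^+ 4] is absorbed using [dl <= 1]. *)
Lemma expect_xi4 k : E (fun w => xi w k ^+ 4) <= 8 * (48 * expR 2^-1 + mu ^+ 4) * dl ^+ 2.
Proof.
have hD := has_moments_D k.
apply: (@le_trans _ _ (E (fun w => 8 * D k w ^+ 4 + 8 * (mu * dl) ^+ 4))).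
  apply: expect_le.
  - exact: has_momentsX (has_moments_xi k).
  - apply: has_momentsD; last exact: has_moments_cst.
    by apply: has_momentsZ; exact: has_momentsX.
  - move=> w; set a := D k w; set b := mu * dl.
    have h1 : (a - b) ^+ 2 <= 2 * a ^+ 2 + 2 * b ^+ 2.
      by have := sqr_ge0 (a + b); nra.
    have h2 : ((a - b) ^+ 2) ^+ 2 <= (2 * a ^+ 2 + 2 * b ^+ 2) ^+ 2.
      have := sqr_ge0 a; have := sqr_ge0 b => b2 a2.
      by rewrite lerXn2r ?nnegrE ?sqr_ge0//; lra.
    rewrite -exprM in h2; apply: (le_trans h2).
    by have := sqr_ge0 (a ^+ 2 - b ^+ 2); nra.
rewrite expectD; [|by apply: has_momentsZ; exact: has_momentsX|exact: has_moments_cst].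
rewrite expect_cst expectZ; last exact: has_momentsX.
have := expect_gaussian4 _ _ _ sqrt_dl_gt0 (mD k) (lawD k).
have -> : Num.sqrt dl ^+ 4 = dl ^+ 2.
  by rewrite (exprM (Num.sqrt dl) 2 2) sqr_sqrtr// ltW.
move=> h.
have d4 : dl ^+ 4 <= dl ^+ 2 by apply: ler_wiXn2l => //; exact: ltW.
have m4 : 0 <= mu ^+ 4 by exact: exprn_ge0 (ltW mu0).
rewrite exprMn; have := ler_wpM2l m4 d4; lra.
Qed.

(** The drift contributes - mu ^ 2 H and the Gaussian part mu ^ 2 H / 2. Among the exponents th, the
    choice th = mu minimizes - th mu H + th ^ 2 H / 2. *)
Lemma expect_expW n : E (fun w => expR (mu * (y + W n w - mu * (n%:R * dl)))) =
  expR (mu * y - mu ^+ 2 * (n%:R * dl) / 2).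
Proof.
case: n => [|n].
  under eq_Rintegral do rewrite /W big_ord0.
  by rewrite expect_cst; congr expR; rewrite mul0r; ring.
have k0 : 0 < n.+1%:R * dl by rewrite mulr_gt0.
have sk0 : 0 < Num.sqrt (n.+1%:R * dl) by rewrite sqrtr_gt0.
have mW : measurable_fun setT (W n.+1) := has_moments_measurable _ _ (has_moments_W _).
have lW U : measurable U -> P (W n.+1 @^-1` U) = normal_prob 0 (Num.sqrt (n.+1%:R * dl)) U.
  exact: lawW.
transitivity (E (fun w => expR (mu * (y - mu * (n.+1%:R * dl))) * expR (mu * W n.+1 w))).
  by apply: eq_Rintegral => w _; rewrite -expRD; congr expR; ring.
rewrite expectZ; last exact: has_moments_expR_gaussian sk0 mW lW mu.
rewrite (expect_expR_gaussian _ _ _ sk0 mW lW) -expRD sqr_sqrtr ?ltW//.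
by congr expR; field.
Qed.

Lemma has_moments_expW n :
  has_moments P (fun w => expR (mu * (y + W n w - mu * (n%:R * dl)))).
Proof.
case: n => [|n].
  by under eq_fun do rewrite /W big_ord0; exact: has_moments_cst.
have k0 : 0 < n.+1%:R * dl by rewrite mulr_gt0.
have sk0 : 0 < Num.sqrt (n.+1%:R * dl) by rewrite sqrtr_gt0.
have mW : measurable_fun setT (W n.+1) := has_moments_measurable _ _ (has_moments_W _).
have lW U : measurable U -> P (W n.+1 @^-1` U) = normal_prob 0 (Num.sqrt (n.+1%:R * dl)) U.
  exact: lawW.
have := has_momentsZ P (expR (mu * (y - mu * (n.+1%:R * dl)))) _
  (has_moments_expR_gaussian _ _ _ sk0 mW lW mu).
suff -> : (fun w => expR (mu * (y + W n.+1 w - mu * (n.+1%:R * dl)))) =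
  (fun w => expR (mu * (y - mu * (n.+1%:R * dl))) * expR (mu * W n.+1 w)) by [].
by apply/funext => w; rewrite -expRD; congr expR; ring.
Qed.

Lemma expect_prod_close n eps H : H = n%:R * dl -> 1 <= H -> 0 < eps -> eps <= 1 ->
  `|E (fun w => clk n w * are n w) - mean_product dl mu y| <=
    ((2 * mu)^-1 + ((2 * mu ^+ 2)^-1 + 2^-1) + mu^-1 + (2 * mu ^+ 2)^-1 +
      (mu ^- 3 + (2 * mu)^-1) + mu ^- 4) * H *
    (eps + 8 * (48 * expR 2^-1 + mu ^+ 4) * H * dl / eps ^+ 3 +
      (mu^-1 + 2 / mu ^+ 2 + 6 / mu ^+ 3) *
      expR (mu * y - mu ^+ 2 * H / 2) / eps) +
    eps * (H ^+ 2 * (2 * y ^+ 2 + 2 * H)) / mu.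
Proof.
move=> HE H1 e0 e1.
set K := (2 * mu)^-1 + ((2 * mu ^+ 2)^-1 + 2^-1) + mu^-1 + (2 * mu ^+ 2)^-1 +
  (mu ^- 3 + (2 * mu)^-1) + mu ^- 4.
set C := mu^-1 + 2 / mu ^+ 2 + 6 / mu ^+ 3.
have hp : has_moments P (fun w => clk n w * are n w).
  by apply: has_momentsM; [exact: has_moments_clock|exact: has_moments_area].
have hR := has_moments_remainder n.
rewrite -(expect_compensated n) /compensated expectD//.
rewrite opprD addrA subrr add0r normrN.
apply: (le_trans (le_normr_Rintegral measurableT (has_moments_integrable _ _ hR))).
(* [u] dominates the fourth power of any overshoot; [z] is the exponential of the free walk, with
   which the stopped walk coincides as long as it is alive. *)
pose u w := \sum_(j < n) xi w j ^+ 4.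
pose z w := expR (mu * (y + W n w - mu * (n%:R * dl))).
have hxi j : has_moments P (fun w => xi w j ^+ 4) by exact: has_momentsX (has_moments_xi j).
have hu : has_moments P u by exact: (has_moments_sum P n (fun j w => xi w j ^+ 4)).
have hz : has_moments P z by exact: has_moments_expW.
have ha2 : has_moments P (fun w => are n w ^+ 2) by exact: has_momentsX (has_moments_area n).
have hb : has_moments P (fun w => K * H * (eps + eps ^- 3 * u w + C / eps * z w)).
  apply: has_momentsZ; apply: has_momentsD; last exact: has_momentsZ.
  by apply: has_momentsD; [exact: has_moments_cst|exact: has_momentsZ].
have hb2 : has_moments P (fun w => eps / mu * are n w ^+ 2) by exact: has_momentsZ.
apply: (@le_trans _ _ (E (fun w => K * H * (eps + eps ^- 3 * u w + C / eps * z w) +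
    eps / mu * are n w ^+ 2))).
  apply: expect_le.
  - split; first by apply: measurableT_comp => //; exact: has_moments_measurable hR.
    by move=> k; under eq_fun do rewrite normr_id; exact: hR.2.
  - exact: has_momentsD.
  - move=> w; apply: (le_trans (remainder_le _ _ _ _ _ H eps (u w) (z w)
      _ _ _ _ _ _ _ _ _ _ _ _ _)) => //.
    + by apply: clock_ge0; exact: ltW.
    + by rewrite HE; apply: clock_le; exact: ltW.
    + by apply: area_ge0; exact: ltW.
    + exact: overshoot_le.
    + by apply: sumr_ge0 => j _; rewrite exprn_even_ge0.
    + move=> s0; have [_ ->] := stopped_gt0 _ _ _ s0.
      by rewrite /z ler_expR sumxi addrA.
    + exact: expR_ge0.
    + rewrite -/K -/C; apply: lerD; last by rewrite mulrAC.
      by rewrite [u w / _]mulrC [C * z w / eps]mulrAC.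
rewrite expectD// expectZ; last first.
  apply: has_momentsD; last exact: has_momentsZ.
  by apply: has_momentsD; [exact: has_moments_cst|exact: has_momentsZ].
rewrite expectD; last 2 first.
- by apply: has_momentsD; [exact: has_moments_cst|exact: has_momentsZ].
- exact: has_momentsZ.
rewrite expectD; last 2 first.
- exact: has_moments_cst.
- exact: has_momentsZ.
rewrite expect_cst !expectZ//.
have K0 : 0 <= K.
  by rewrite /K !addr_ge0// ?invr_ge0 ?mulr_ge0 ?exprn_ge0// ltW.
have C0 : 0 <= C.
  by rewrite /C !addr_ge0// ?divr_ge0 ?invr_ge0 ?exprn_ge0// ltW.
have H0 : 0 <= H := le_trans ler01 H1.
apply: lerD; last first.
  by rewrite [leRHS]mulrAC ler_wpM2l ?divr_ge0 ?(ltW mu0) ?(ltW e0)// HE; exact: expect_area2.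
rewrite ler_wpM2l ?mulr_ge0//; apply: lerD.
  rewrite lerD2l mulrC ler_wpM2r ?invr_ge0 ?exprn_ge0 ?(ltW e0)//.
  rewrite /u (expect_sum P n (fun j w => xi w j ^+ 4))//.
  apply: (@le_trans _ _ (\sum_(j < n) (8 * (48 * expR 2^-1 + mu ^+ 4) * dl ^+ 2))).
    by apply: ler_sum => j _; exact: expect_xi4.
  by rewrite sumr_const card_ord HE -mulr_natl expr2 le_eqVlt; apply/orP; left; apply/eqP; ring.
by rewrite /z expect_expW -HE mulrAC.
Qed.

End gaussian_walk.

(** * Choice of the parameters *)

Section rates.
Context {R : realType}.

Lemma expRN_le (z : R) n : 0 < z -> expR (- z) <= n.+1`!%:R / z ^+ n.+1.
Proof.
move=> z0; have := expR_ge1Dxn n (ltW z0).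
rewrite expRN -[_ / z ^+ _]invf_div => h.
rewrite lef_pV2 ?posrE ?expR_gt0// ?divr_gt0 ?exprn_gt0 ?ltr0n ?fact_gt0//.
by apply: le_trans h; rewrite lerDr.
Qed.

(** The bound of [expect_prod_close] with eps = H ^ -4. The squared area has mean of order H ^ 3, so
    its term becomes of order 1 / H; in exchange the exponential term carries a factor H ^ 5, which
    the exponential decay beats. [K1] is chosen before [H], [K2] after it. *)
Lemma rate_bound (mu y : R) : 0 < mu -> exists2 K1 : R, 0 <= K1 &
  forall H : R, 1 <= H -> exists2 K2 : R, 0 <= K2 &
  forall dl, 0 < dl ->
    ((2 * mu)^-1 + ((2 * mu ^+ 2)^-1 + 2^-1) + mu^-1 + (2 * mu ^+ 2)^-1 +
      (mu ^- 3 + (2 * mu)^-1) + mu ^- 4) * H *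
    (H ^- 4 + 8 * (48 * expR 2^-1 + mu ^+ 4) * H * dl / (H ^- 4) ^+ 3 +
      (mu^-1 + 2 / mu ^+ 2 + 6 / mu ^+ 3) *
      expR (mu * y - mu ^+ 2 * H / 2) / H ^- 4) +
    H ^- 4 * (H ^+ 2 * (2 * y ^+ 2 + 2 * H)) / mu +
    `|mean_product dl mu y - mean_product 0 mu y| <= K1 / H + K2 * dl.
Proof.
move=> mu0.
set K := (2 * mu)^-1 + ((2 * mu ^+ 2)^-1 + 2^-1) + mu^-1 + (2 * mu ^+ 2)^-1 +
  (mu ^- 3 + (2 * mu)^-1) + mu ^- 4.
set C := mu^-1 + 2 / mu ^+ 2 + 6 / mu ^+ 3.
set c := 8 * _.
have K0 : 0 <= K.
  by rewrite /K !addr_ge0// ?invr_ge0 ?mulr_ge0 ?exprn_ge0// ltW.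
have C0 : 0 <= C.
  by rewrite /C !addr_ge0// ?divr_ge0 ?invr_ge0 ?exprn_ge0// ltW.
have c0 : 0 <= c.
  rewrite /c; apply: mulr_ge0 => //; apply: addr_ge0; last exact: exprn_ge0 (ltW mu0).
  by apply: mulr_ge0 => //; exact: expR_ge0.
(* From expR (- z) <= 6! / z ^ 6 at z = mu ^ 2 H / 2: the sixth power turns the factor H ^ 5 into 1
   / H. *)
pose J := expR (mu * y) * (6`!%:R * (2 / mu ^+ 2) ^+ 6).
have J0 : 0 <= J.
  rewrite /J mulr_ge0 ?expR_ge0// mulr_ge0 ?ler0n// exprn_ge0//.
  by rewrite divr_ge0// exprn_ge0// ltW.
exists (K + K * C * J + (2 * y ^+ 2 + 2) / mu).
  apply: addr_ge0; first by apply: addr_ge0 => //; apply: mulr_ge0 => //; apply: mulr_ge0.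
  by apply: divr_ge0; [have := sqr_ge0 y; lra|exact: ltW].
move=> H H1; have H0 : 0 < H := lt_le_trans ltr01 H1.
have Hn0 : H != 0 by rewrite gt_eqF.
(* H ^ 14 is H from the prefactor, H from the number of steps and H ^ 12 from eps ^ -3; the second
   summand pays for the [dl] correction in [mean_product]. *)
exists (K * c * H ^+ 14 + y ^+ 2 / (2 * mu)).
  apply: addr_ge0.
    by apply: mulr_ge0; [exact: mulr_ge0|exact: exprn_ge0 (ltW H0)].
  by apply: divr_ge0; [exact: sqr_ge0|apply: mulr_ge0 => //; exact: ltW].
move=> dl dl0.
have mp : `|mean_product dl mu y - mean_product 0 mu y| = dl * (y ^+ 2 / (2 * mu)).
  rewrite (_ : _ - _ = dl * (y ^+ 2 / (2 * mu))).
    rewrite ger0_norm//; apply: mulr_ge0; first exact: ltW.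
    by apply: divr_ge0; [exact: sqr_ge0|apply: mulr_ge0 => //; exact: ltW].
  by rewrite /mean_product; field; rewrite gt_eqF.
have z0 : 0 < mu ^+ 2 * H / 2 by rewrite divr_gt0// mulr_gt0// exprn_gt0.
have e : expR (mu * y - mu ^+ 2 * H / 2) <= J / H ^+ 6.
  rewrite expRD /J -[leRHS]mulrA; apply: ler_wpM2l; first exact: expR_ge0.
  apply: (le_trans (expRN_le _ 5 z0)); rewrite -[leRHS]mulrA.
  apply: ler_wpM2l; first exact: ler0n.
  rewrite le_eqVlt; apply/orP; left; apply/eqP.
  by field; rewrite Hn0 gt_eqF.
have Hi : H^-1 <= 1 by rewrite invf_le1.
have Hi0 : 0 < H^-1 by rewrite invr_gt0.
have t1 : K * H * H ^- 4 <= K / H.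
  rewrite (_ : K * H * H ^- 4 = K / H * (H^-1 * H^-1)); last by field.
  apply: ler_piMr; first by apply: divr_ge0 => //; exact: ltW.
  by apply: mulr_ile1 => //; exact: ltW.
have t2 : K * H * (c * H * dl / (H ^- 4) ^+ 3) = K * c * H ^+ 14 * dl by field.
have t3 : K * H * (C * expR (mu * y - mu ^+ 2 * H / 2) / H ^- 4) <= K * C * J / H.
  rewrite (_ : K * C * J / H = K * H * (C * (J / H ^+ 6) / H ^- 4)); last by field.
  apply: ler_wpM2l; first by apply: mulr_ge0 => //; exact: ltW.
  apply: ler_wpM2r; first by rewrite invrK exprn_ge0// ltW.
  exact: ler_wpM2l.
have t4 : H ^- 4 * (H ^+ 2 * (2 * y ^+ 2 + 2 * H)) / mu <= (2 * y ^+ 2 + 2) / mu / H.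
  rewrite (_ : H ^- 4 * _ / mu = (2 * y ^+ 2 / H + 2) / mu / H); last first.
    by field; rewrite Hn0 gt_eqF.
  rewrite ler_wpM2r ?(ltW Hi0)// ler_wpM2r ?invr_ge0 ?(ltW mu0)// lerD2r.
  by rewrite ler_piMr// mulr_ge0// sqr_ge0.
rewrite mp 2!(mulrDr (K * H)) t2.
set Y := (2 * y ^+ 2 + 2) / mu in t4 *; set v := y ^+ 2 / (2 * mu).
rewrite [leRHS](_ : _ = K / H + K * c * H ^+ 14 * dl + K * C * J / H + Y / H + dl * v).
  by rewrite lerD2r; apply: lerD => //; apply: lerD => //; rewrite lerD2r.
by ring.
Qed.

End rates.

(** * Integrals of nonmeasurable functions *)

Section integral_without_measurability.
Context {d : measure_display} {T : measurableType d} {R : realType}.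
Variable m : {measure set T -> \bar R}.
Local Open Scope ereal_scope.
Implicit Types (f g U L : T -> \bar R) (N : set T).

(* The integral of a nonnegative function is the supremum of the integrals of
   the simple functions below it, measurable or not. *)
Lemma ge0_le_integral_sup f g : (forall x, 0 <= f x) ->
  (forall x, f x <= g x) -> \int[m]_x f x <= \int[m]_x g x.
Proof.
move=> f0 fg; have g0 x : 0 <= g x := le_trans (f0 x) (fg x).
rewrite !ge0_integralTE//; apply: ereal_sup_le => _ [h hf <-]; exists h => //.
by move=> x; exact: le_trans (hf x) (fg x).
Qed.

Variable N : set T.
Hypotheses (mN : measurable N) (N0 : m N = 0).

(** A measurable function that is infinite on [N] and yet has integral 0: adding it dominates
    whatever happens on the null set. *)
Let Z := cst +oo \_ N : T -> \bar R.

Let Z0 x : 0 <= Z x.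
Proof. by rewrite /Z patchE; case: ifP => // _; exact: leey. Qed.

Let Zy x : N x -> Z x = +oo.
Proof. by move=> Nx; rewrite /Z patchE mem_set. Qed.

Let integralZ : \int[m]_x Z x = 0.
Proof. by rewrite -integral_mkcond integral_cst// N0 mule0. Qed.

(** The function may be negative on [N]; its negative part is then dominated by [Z]. *)
Let integral_funepos_off f : (forall x, ~ N x -> 0 <= f x) ->
  \int[m]_x f x = \int[m]_x (f ^\+) x.
Proof.
move=> f0; rewrite [LHS]integralE.
suff -> : \int[m]_x (f ^\-) x = 0 by rewrite sube0.
apply/le_anti/andP; split; last by apply: integral_ge0 => x _; exact: funeneg_ge0.
rewrite -integralZ; apply: ge0_le_integral_sup => x; first exact: funeneg_ge0.
have [Nx|Nx] := pselect (N x); first by rewrite Zy// leey.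
by rewrite (le_trans _ (Z0 x))// funenegE ge_max lexx andbT leeNl oppe0 f0.
Qed.

(** Additivity of the integral is applied only to [U] and [Z], which are measurable; the arbitrary
    [f] enters through monotonicity alone. *)
Lemma integral_le_measurable f U : measurable_fun setT U ->
  (forall x, 0 <= U x) -> (forall x, ~ N x -> 0 <= f x) ->
  (forall x, ~ N x -> f x <= U x) -> \int[m]_x f x <= \int[m]_x U x.
Proof.
move=> mU U0 f0 fU; rewrite [leLHS]integral_funepos_off//.
have mZ : measurable_fun setT Z by apply/measurable_restrict => //; exact: measurable_cst.
rewrite -[leRHS]adde0 -integralZ -ge0_integralD//.
apply: ge0_le_integral_sup => x; first exact: funepos_ge0.
have [Nx|Nx] := pselect (N x).
  by rewrite Zy// addey ?leey// gt_eqF// (lt_le_trans _ (U0 x))// ltNy0.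
by rewrite (le_trans _ (leeDl _ (Z0 x)))// funeposE ge_max U0 fU.
Qed.

(** Here the null set is removed from the measurable side [L]. *)
Lemma measurable_le_integral f L : measurable_fun setT L ->
  (forall x, 0 <= L x) -> (forall x, ~ N x -> 0 <= f x) ->
  (forall x, ~ N x -> L x <= f x) -> \int[m]_x L x <= \int[m]_x f x.
Proof.
move=> mL L0 f0 Lf; rewrite [leRHS]integral_funepos_off//.
rewrite (ge0_negligible_integral mN measurableT mL _ N0)// setTD integral_mkcond.
apply: ge0_le_integral_sup => x.
  by rewrite patchE; case: ifP.
rewrite patchE; case: ifPn => [/set_mem/= Nx|_]; last exact: funepos_ge0.
by rewrite funeposE le_max Lf.
Qed.

End integral_without_measurability.

(** * Comparison of a path with its discretizations *)

Section step_functions.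
Context {R : realType}.
Local Notation leb := (@lebesgue_measure R).
Variable dl : R.
Hypothesis dl0 : 0 < dl.

(** Half-open cells, so that a time of the grid interval lies in exactly one of them. *)
Definition step (c : nat -> R) (n : nat) (s : R) : R :=
  \sum_(k < n) c k * \1_(`[k%:R * dl, k.+1%:R * dl[) s.

Lemma step_cases c n s : step c n s = 0 /\ ~ (0 <= s < n%:R * dl) \/
  exists k : nat, [/\ (k < n)%N, k%:R * dl <= s, s < k.+1%:R * dl & step c n s = c k].
Proof.
elim: n => [|n ih].
  left; rewrite /step big_ord0 mul0r; split=> // /andP[s0 s1].
  by have := le_lt_trans s0 s1; rewrite ltxx.
have stepS : step c n.+1 s = step c n s + c n * \1_(`[n%:R * dl, n.+1%:R * dl[) s.
  by rewrite /step big_ord_recr.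
have [sn|ns] := ltP s (n%:R * dl).
  have e : step c n.+1 s = step c n s.
    rewrite stepS indicE memNset ?mulr0 ?addr0//= in_itv/= => /andP[].
    by rewrite leNgt sn.
  have [[s0 ns]|[k [kn ks sk ck]]] := ih.
    left; rewrite e; split=> // /andP[s1 _]; apply: ns; exact/andP.
  by right; exists k; rewrite e; split=> //; exact: ltnW.
have z : step c n s = 0.
  have [[]//|[k [kn ks sk _]]] := ih.
  have : s < s.
    apply: (lt_le_trans sk); apply: le_trans ns.
    by rewrite ler_wpM2r ?(ltW dl0)// ler_nat.
  by rewrite ltxx.
have [sn1|n1s] := ltP s (n.+1%:R * dl).
  right; exists n; split=> //.
  by rewrite stepS z add0r indicE mem_set ?mulr1//= in_itv/= ns sn1.
left; split; last by rewrite andbF.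
rewrite stepS z add0r indicE memNset ?mulr0//= in_itv/= => /andP[_].
by rewrite ltNge n1s.
Qed.

Lemma step_ge0 c n s : (forall k, 0 <= c k) -> 0 <= step c n s.
Proof. by move=> c0; apply: sumr_ge0 => k _; rewrite mulr_ge0. Qed.

Lemma integral_step c n : (forall k, 0 <= c k) ->
  (\int[leb]_s (step c n s)%:E = (dl * \sum_(k < n) c k)%:E)%E.
Proof.
move=> c0; under eq_integral do rewrite /step -sumEFin.
rewrite ge0_integral_sum//; last 2 first.
- by move=> k; apply/measurable_EFinP; exact: measurable_funM.
- by move=> k s _; rewrite lee_fin mulr_ge0.
rewrite mulr_sumr -sumEFin; apply: eq_bigr => k _.
under eq_integral do rewrite EFinM.
rewrite ge0_integralZl//; last 2 first.
- by apply/measurable_EFinP; exact: measurable_indic.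
- by rewrite lee_fin.
rewrite integral_indic//= setIT lebesgue_measure_itv/= lte_fin ltr_pM2r// ltr_nat ltnSn.
by rewrite -EFinD -EFinM -mulrBl -natr1 addrAC subrr add0r mul1r mulrC.
Qed.

End step_functions.

Section passage.
Context {R : realType}.
Local Notation leb := (@lebesgue_measure R).
Variable X : R -> R.

(** These are [first_passage_time] and [first_passage_area] for a single deterministic path,
    convertible to them when [X] is the drifted path. *)
Definition passage_time : \bar R :=
  ereal_inf [set t%:E | t in [set t : R | 0 < t /\ X t <= 0]].

Definition passage_area : \bar R :=
  (\int[leb]_(t in [set t : R | (0 <= t)%R /\ t%:E <= passage_time]) (X t)%:E)%E.

Hypothesis X0 : 0 <= X 0.
Hypothesis UC : forall H e : R, 0 < e -> exists2 r : R, 0 < r &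
  forall s t, 0 <= s -> s <= H -> 0 <= t -> t <= H -> `|s - t| <= r -> `|X s - X t| <= e.

Lemma passage_time_ge0 : (0 <= passage_time)%E.
Proof. by apply: le_ereal_inf_tmp => _ [t [t0 _] <-]; rewrite lee_fin ltW. Qed.

Lemma gt0_before_passage t : 0 < t -> (t%:E < passage_time)%E -> 0 < X t.
Proof.
move=> t0 tt; rewrite ltNge; apply/negP => Xt.
have : (passage_time <= t%:E)%E by apply: ereal_inf_lbound; exists t.
by rewrite leNgt tt.
Qed.

(** Only the passage time itself needs care: were [X t] negative there, continuity would make [X]
    negative slightly earlier. The maximum with [t / 2] keeps that earlier time positive. *)
Lemma ge0_until_passage t : 0 <= t -> (t%:E <= passage_time)%E -> 0 <= X t.
Proof.
rewrite le_eqVlt => /predU1P[<-//|t0 tT]; rewrite leNgt; apply/negP => Xt.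
have [r r0 hr] := UC t (- X t / 2) ltac:(lra).
pose s := Num.max (t - r) (t / 2).
have s0 : 0 < s by rewrite lt_max divr_gt0 ?orbT.
have st : s < t by rewrite gt_max; apply/andP; split; lra.
have tr : t - r <= s by rewrite le_max lexx.
have sr : t - s <= r by lra.
have := hr s t (ltW s0) (ltW st) (ltW t0) (lexx t).
rewrite ler0_norm ?subr_le0 ?(ltW st)// opprB => /(_ sr); rewrite ler_norml => /andP[_ h].
have Xs : 0 < X s by apply: gt0_before_passage => //; apply: lt_le_trans tT; rewrite lte_fin.
lra.
Qed.

Let dom := [set t : R | (0 <= t)%R /\ (t%:E <= passage_time)%E].

Lemma passage_area_ge0 : (0 <= passage_area)%E.
Proof.
by apply: integral_ge0 => t [t0 tT]; rewrite lee_fin; exact: ge0_until_passage.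
Qed.

Variables (dl eta : R) (n : nat).
Hypotheses (dl0 : 0 < dl) (eta0 : 0 < eta).
Hypothesis osc : forall s t, 0 <= s -> s <= n%:R * dl -> 0 <= t -> t <= n%:R * dl ->
  `|s - t| <= dl -> `|X s - X t| <= eta.

Local Notation xi := (fun j : nat => X (j.+1%:R * dl) - X (j%:R * dl)).

Let sum_xi y k : y + \sum_(j < k) xi j = y - X 0 + X (k%:R * dl).
Proof.
rewrite -(big_mkord xpredT xi) telescope_sumr// mul0r; ring.
Qed.

Let grid_le j k : (j <= k)%N -> j%:R * dl <= k%:R * dl.
Proof. by move=> jk; rewrite ler_wpM2r ?(ltW dl0)// ler_nat. Qed.

Let grid_ge0 j : 0 <= j%:R * dl.
Proof. by rewrite mulr_ge0// ltW. Qed.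

Let osc_grid k s : (k < n)%N -> k%:R * dl <= s -> s <= k.+1%:R * dl ->
  `|X s - X (k%:R * dl)| <= eta.
Proof.
move=> kn ks sk; apply: osc => //.
- exact: le_trans (grid_ge0 k) ks.
- exact: le_trans sk (grid_le _ _ kn).
- exact: grid_le (ltnW kn).
- rewrite ger0_norm ?subr_ge0//; move: sk; rewrite -natr1 mulrDl mul1r; lra.
Qed.

(** For the walk started [eta] too low, being alive at a grid point means that [X] exceeds [eta]
    there, and over the adjoining cell [X] loses at most [eta]. *)
Let alive_gt0 k s : (k < n)%N -> 0 < stopped (X 0 - eta) xi k ->
  0 <= s -> s <= k.+1%:R * dl -> 0 < X s.
Proof.
move=> kn /[dup] /stopped_gt0[Spos _] _ s0 sk.
(* The zero coefficients only serve to locate the cell of [s]. There are [k.+2] cells because [s]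
   may be the right endpoint of cell [k], which belongs to the next one. *)
have [[_]|[j [jk js sj _]]] := step_cases dl dl0 (fun=> 0) k.+2 s.
  by case; rewrite s0/=; apply: le_lt_trans sk _; rewrite ltr_pM2r// ltr_nat.
have [jk1|jk1] := leqP j k.
  have [_ e] := stopped_gt0 _ _ _ (Spos j jk1).
  have := Spos j jk1; rewrite e sum_xi.
  have := osc_grid j s (leq_ltn_trans jk1 kn) js (ltW sj).
  by rewrite ler_norml => /andP[h _]; lra.
have kj : s = k.+1%:R * dl by apply/le_anti; rewrite sk (le_trans _ js)// grid_le.
have [_ e] := stopped_gt0 _ _ _ (Spos k (leqnn k)).
have := Spos k (leqnn k); rewrite e sum_xi.
have := osc_grid k s kn _ sk; rewrite {1}kj => /(_ (grid_le _ _ (leqnSn k))).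
by rewrite ler_norml => /andP[h _]; lra.
Qed.

Let alive_passage k : (k < n)%N -> 0 < stopped (X 0 - eta) xi k ->
  ((k.+1%:R * dl)%:E <= passage_time)%E.
Proof.
move=> kn Sk; apply: le_ereal_inf_tmp => _ [t [t0 Xt] <-]; rewrite lee_fin leNgt.
apply/negP => tk; have := alive_gt0 k t kn Sk (ltW t0) (ltW tk).
by rewrite ltNge Xt.
Qed.

Lemma clock_le_passage : ((clock dl (X 0 - eta) xi n)%:E <= passage_time)%E.
Proof.
suff h k : (k <= n)%N -> ((clock dl (X 0 - eta) xi k)%:E <= passage_time)%E by exact: h.
elim: k => [_|k ih kn].
  by rewrite /clock big_ord0 mulr0 passage_time_ge0.
have [Sk|Sk] := ltP 0 (stopped (X 0 - eta) xi k).
  apply: le_trans (alive_passage k kn Sk); rewrite lee_fin.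
  by apply: clock_le; exact: ltW.
rewrite /clock big_ord_recr /= positive_ind0// addr0; exact: ih (ltnW kn).
Qed.

Lemma area_le_passage : ((area dl (X 0 - eta) xi n)%:E <= passage_area)%E.
Proof.
pose c k := positive_ind (stopped (X 0 - eta) xi k) * stopped (X 0 - eta) xi k.
have c0 k : 0 <= c k by exact: positive_indM_ge0.
rewrite /area -(integral_step dl dl0 c n c0) /passage_area [leRHS]integral_mkcond.
apply: ge0_le_integral_sup => s; first by rewrite lee_fin step_ge0.
have X_ge0 : (0 <= (EFin \o X \_ dom) s)%E.
  rewrite /= patchE; case: ifPn => // /set_mem [s0 sT].
  by rewrite lee_fin ge0_until_passage.
have -> : ((fun t => (X t)%:E) \_ [set t | 0 <= t /\ (t%:E <= passage_time)%E]) s =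
    (EFin \o X \_ dom) s.
  by rewrite /= !patchE; case: ifP.
have [[-> _]//|[k [kn ks sk ->]]] := step_cases dl dl0 c n s.
have [Sk|Sk] := ltP 0 (stopped (X 0 - eta) xi k); last first.
  by rewrite /c positive_ind0// mul0r.
have s0 : 0 <= s := le_trans (grid_ge0 k) ks.
have sT : (s%:E <= passage_time)%E.
  by apply: le_trans (alive_passage k kn Sk); rewrite lee_fin ltW.
rewrite /= patchE mem_set// lee_fin /c positive_ind1// mul1r.
have [_ ->] := stopped_gt0 _ _ _ Sk; rewrite sum_xi.
have := osc_grid k s kn ks (ltW sk); rewrite ler_norml => /andP[h _]; lra.
Qed.

(** The walk started [eta] too high stays at least [eta] at all grid points up to the passage time,
    since the path is nonnegative there. *)
Let alive_upper k : ((k%:R * dl)%:E <= passage_time)%E ->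
  0 < stopped (X 0 + eta) xi k /\ stopped (X 0 + eta) xi k = X (k%:R * dl) + eta.
Proof.
move=> kT.
have Sk : 0 < stopped (X 0 + eta) xi k.
  apply: stopped_alive => j jk; rewrite sum_xi.
  rewrite [X 0 + eta]addrC addrK ltr_wpDr//.
  by apply: ge0_until_passage => //; apply: le_trans kT; rewrite lee_fin grid_le.
by split=> //; have [_ ->] := stopped_gt0 _ _ _ Sk; rewrite sum_xi; ring.
Qed.

Section upper.
Hypothesis passage_lt : (passage_time < (n%:R * dl)%:E)%E.

Let integral_dom_le (f : R -> R) (c : nat -> R) : (forall k, 0 <= c k) ->
  (forall s, dom s -> 0 <= f s) ->
  (forall k s, (k < n)%N -> dom s -> k%:R * dl <= s -> s < k.+1%:R * dl -> f s <= c k) ->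
  (\int[leb]_(t in dom) (f t)%:E <= (dl * \sum_(k < n) c k)%:E)%E.
Proof.
move=> c0 f0 fc; rewrite -(integral_step dl dl0 c n c0) [leLHS]integral_mkcond.
apply: ge0_le_integral_sup => s; rewrite patchE; case: ifPn => //.
- by move=> /set_mem; rewrite lee_fin; exact: f0.
- move=> /set_mem ds; have [s0 sT] := ds; rewrite lee_fin.
  have [[_]|[k [kn ks sk ->]]] := step_cases dl dl0 c n s; last exact: fc.
  by case; rewrite s0 -lte_fin; exact: le_lt_trans passage_lt.
- by move=> _; rewrite lee_fin step_ge0.
Qed.

Lemma passage_le_clock : (passage_time <= (clock dl (X 0 + eta) xi n)%:E)%E.
Proof.
have Tfin : passage_time \is a fin_num.
  by rewrite ge0_fin_numE ?passage_time_ge0// (lt_trans passage_lt)// ltry.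
have domE : dom = `[0, fine passage_time]%classic.
  apply/seteqP; split=> t /=; rewrite in_itv/= -(lee_fin t) fineK//.
  by move=> [-> ->].
  by move=> /andP[].
(* Writing the time as the integral of 1 lets the comparison with step functions treat it like the
   area. *)
have {1}-> : passage_time = (\int[leb]_(t in dom) (1 : R)%:E)%E.
  rewrite domE integral_cst//= mul1e lebesgue_measure_itv/= lte_fin.
  case: ltP => [_|]; first by rewrite EFinN sube0 fineK.
  rewrite -lee_fin fineK// => T0; apply/le_anti; rewrite T0 /=.
  exact: passage_time_ge0.
apply: (integral_dom_le (fun=> 1)
  (fun k => positive_ind (stopped (X 0 + eta) xi k))) => //.
move=> k s kn [s0 sT] ks sk.
have [|Sk _] := alive_upper k; first by apply: le_trans sT; rewrite lee_fin.
by rewrite positive_ind1.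
Qed.

Lemma passage_le_area : (passage_area <= (area dl (X 0 + eta) xi n)%:E)%E.
Proof.
apply: (integral_dom_le X (fun k =>
  positive_ind (stopped (X 0 + eta) xi k) * stopped (X 0 + eta) xi k)).
- by move=> k; exact: positive_indM_ge0.
- by move=> s [s0 sT]; exact: ge0_until_passage.
- move=> k s kn [s0 sT] ks sk.
  have [|Sk e] := alive_upper k; first by apply: le_trans sT; rewrite lee_fin.
  rewrite positive_ind1// mul1r e.
  by have := osc_grid k s kn ks (ltW sk); rewrite ler_norml => /andP[]; lra.
Qed.

End upper.

(** Covers paths that never reach 0, which are not discarded as a null set: the upper walk then
    lives up to the horizon at height at least [eta], so its product exceeds every real number as
    the horizon grows. *)
Lemma prod_ge_of_no_passage : passage_time = +oo%E ->
  eta * (n%:R * dl) ^+ 2 <= clock dl (X 0 + eta) xi n * area dl (X 0 + eta) xi n.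
Proof.
move=> T; have al k := alive_upper k; rewrite T in al.
have e k := (al k (leey _)).2; have Sk k := (al k (leey _)).1.
have -> : clock dl (X 0 + eta) xi n = n%:R * dl.
  rewrite /clock (eq_bigr (fun=> 1)) => [|k _]; last by rewrite positive_ind1.
  by rewrite sumr_const card_ord mulrC.
rewrite expr2 mulrCA ler_wpM2l// /area (_ : eta * _ = dl * \sum_(k < n) eta); last first.
  by rewrite sumr_const card_ord -mulr_natl; ring.
rewrite ler_wpM2l ?(ltW dl0)//; apply: ler_sum => k _.
rewrite positive_ind1// mul1r e lerDr; apply: ge0_until_passage => //.
by rewrite T leey.
Qed.

Lemma prod_le_passage :
  ((clock dl (X 0 - eta) xi n * area dl (X 0 - eta) xi n)%:E <=
   passage_time * passage_area)%E.
Proof.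
rewrite EFinM; apply: lee_pmul.
- by rewrite lee_fin clock_ge0// ltW.
- by rewrite lee_fin area_ge0// ltW.
- exact: clock_le_passage.
- exact: area_le_passage.
Qed.

Lemma passage_le_prod : (passage_time < (n%:R * dl)%:E)%E ->
  (passage_time * passage_area <=
   (clock dl (X 0 + eta) xi n * area dl (X 0 + eta) xi n)%:E)%E.
Proof.
move=> Tn; rewrite EFinM; apply: lee_pmul.
- exact: passage_time_ge0.
- exact: passage_area_ge0.
- exact: passage_le_clock.
- exact: passage_le_area.
Qed.

End passage.

(** * Uniform continuity on bounded intervals *)

Section uniform_continuity.
Context {R : realType}.

Lemma within_uniform_continuous (f : R -> R) :
  {within `[0, +oo[, continuous f} ->
  forall H e : R, 0 < e -> exists2 r : R, 0 < r &
  forall s t, 0 <= s -> s <= H -> 0 <= t -> t <= H -> `|s - t| <= r -> `|f s - f t| <= e.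
Proof.
move=> /subspace_continuousP cf H e e0.
have /compact_near_coveringP cov := @segment_compact R 0 H.
(* The guard [0 <= s] is there because neighbourhoods of points near 0 contain negative times, where
   nothing is known about [f]. *)
pose Q (r s : R) := 0 <= s -> forall t, 0 <= t -> `|s - t| <= r -> `|f s - f t| <= e.
have h : \forall r \near (0 : R)^'+, `[0, H]%classic `<=` Q r.
  apply: cov => x /=.
  rewrite in_itv/= => /andP[x0 xH].
  have xI : `[0, +oo[%classic x by rewrite /= in_itv/= x0.
  have e20 : 0 < e / 2 by rewrite divr_gt0.
  have /cvgrPdist_lt /(_ (e / 2) e20) := cf x xI.
  rewrite near_withinE => /nbhs_ballP[r /= r0 hr].
  exists (ball x (r / 2), [set q | 0 < q < r / 2]) => /=.
    split; first by apply: nbhsx_ballx; rewrite divr_gt0.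
    have r20 : 0 < r / 2 by rewrite divr_gt0.
    by apply: filterS2 (nbhs_right_gt 0) (nbhs_right_lt r20) => q /= -> ->.
  move=> [s q] /= [xs /andP[q0 qr]] s0 t t0 st.
  have fs : `|f x - f s| < e / 2.
    apply: hr; last by rewrite /= in_itv/= s0.
    by apply: lt_trans xs _; lra.
  have ft : `|f x - f t| < e / 2.
    apply: hr; last by rewrite /= in_itv/= t0.
    rewrite /ball/= -[x](subrK s) -addrA (le_lt_trans (ler_normD _ _))//.
    move: xs; rewrite /ball/=; lra.
  rewrite -[f s](subrK (f x)) -addrA (le_trans (ler_normD _ _))// distrC; lra.
have [r [r0 hr]] : exists r : R, 0 < r /\ `[0, H]%classic `<=` Q r.
  by near (0 : R)^'+ => r; exists r; split=> //; near: r.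
exists r => // s t s0 sH t0 tH st; apply: (hr s) => //.
by rewrite /= in_itv/= s0.
Unshelve. all: by end_near. Qed.

End uniform_continuity.

(** * Bounds for the integral of a possibly nonmeasurable function *)

Section fatou_bounds.
Context {R : realType}.
Local Open Scope ereal_scope.
Implicit Types u : (\bar R)^nat.

Lemma le_limn_einf u (a : \bar R) (N : nat) :
  (forall n, (N <= n)%N -> a <= u n) -> a <= limn_einf u.
Proof.
move=> h; rewrite limn_einf_lim (cvg_lim _ (@cvg_einfs_sup _ u))//.
apply: (@le_trans _ _ (einfs u N)); last by apply: ereal_sup_ubound; exists N.
by apply: le_ereal_inf_tmp => _ [n /= Nn <-]; exact: h.
Qed.

Lemma limn_einf_le u (a : \bar R) (N : nat) :
  (forall n, (N <= n)%N -> u n <= a) -> limn_einf u <= a.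
Proof.
move=> h; rewrite limn_einf_lim (cvg_lim _ (@cvg_einfs_sup _ u))//.
apply: ge_ereal_sup => _ [n _ <-].
apply: (@le_trans _ _ (u (maxn n N))); last by apply: h; rewrite leq_maxr.
by apply: ereal_inf_lbound; exists (maxn n N) => //=; rewrite leq_maxl.
Qed.

Context {d : measure_display} {T : measurableType d}.

Lemma measurable_fun_limn_einf (g : (T -> \bar R)^nat) :
  (forall n, measurable_fun setT (g n)) ->
  measurable_fun setT (fun w => limn_einf (g^~ w)).
Proof.
move=> mg.
have -> : (fun w => limn_einf (g^~ w)) = (fun w => - limn_esup (fun n => - g n w)).
  by apply/funext => w; rewrite -[limn_einf _]oppeK -limn_esupN.
apply: measurableT_comp => //.
by apply: (measurable_fun_limn_esup (f := fun n w => - g n w)) => n; exact: measurableT_comp.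
Qed.

Variable P : probability T R.
Variable N : set T.
Hypotheses (mN : measurable N) (N0 : P N = 0).
Variable f : T -> \bar R.
Hypothesis f0 : forall w, ~ N w -> 0 <= f w.

Lemma half_pow_small (K e : R) : (0 <= K)%R -> (0 < e)%R ->
  exists m0 : nat, forall m, (m0 <= m)%N -> (K * (2 ^+ m)^-1 <= e)%R.
Proof.
move=> K0 e0; exists (Num.truncn (K / e)).+1 => m hm.
rewrite ler_pdivrMr ?exprn_gt0// mulrC -ler_pdivrMr//.
apply: (@le_trans _ _ m%:R%R).
  by apply: (le_trans (ltW (truncnS_gt _))); rewrite ler_nat.
by rewrite -natrX ler_nat ltnW// ltn_expl.
Qed.

Lemma expect_EFin (X : T -> R) : has_moments P X ->
  \int[P]_w (X w)%:E = (\int[P]_w X w)%R%:E.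
Proof.
by move=> /has_moments_integrable hX; rewrite fineK//; exact: integrable_fin_num.
Qed.

(** Fatou's lemma is applied twice, first in [m] at fixed [h], because [K2 h] is not uniform in [h].
    The pointwise hypothesis runs over reals [a] below [f w], so that an infinite value of [f w] is
    covered too. *)
Lemma integral_le_double_limit (Y : nat -> nat -> T -> R) (v K1 : R) (K2 : nat -> R) :
  (forall h m, has_moments P (Y h m)) -> (forall h m w, (0 <= Y h m w)%R) ->
  (forall h, (0 <= K2 h)%R) -> (0 <= K1)%R ->
  (forall h m, ((\int[P]_w Y h m w)%R <= v + K1 / h.+1%:R + K2 h * (2 ^+ m)^-1)%R) ->
  (forall w, ~ N w -> forall a : R, a%:E <= f w -> exists h0, forall h, (h0 <= h)%N ->
    exists m0, forall m, (m0 <= m)%N -> (a <= Y h m w)%R) ->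
  \int[P]_w f w <= v%:E.
Proof.
move=> hY Y0 K20 K10 EY fY.
have mY h m : measurable_fun setT (fun w => (Y h m w)%:E).
  by apply/measurable_EFinP; exact: has_moments_measurable (hY h m).
pose L1 h w := limn_einf (fun m => (Y h m w)%:E).
pose L w := limn_einf (fun h => L1 h w).
have mL1 h : measurable_fun setT (L1 h) by exact: measurable_fun_limn_einf.
have L10 h w : 0 <= L1 h w by apply: (le_limn_einf _ _ 0%N) => m _; rewrite lee_fin.
have mL : measurable_fun setT L by exact: measurable_fun_limn_einf.
have L0 w : 0 <= L w by apply: (le_limn_einf _ _ 0%N) => h _; exact: L10.
have EL1 h : \int[P]_w L1 h w <= (v + K1 / h.+1%:R)%:E.
  apply: (le_trans (fatou P measurableT (mY h) (fun m w _ => Y0 h m w))).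
  apply/lee_addgt0Pr => e e0; have [m0 hm0] := half_pow_small _ _ (K20 h) e0.
  apply: (limn_einf_le _ _ m0) => m mm; rewrite expect_EFin// -EFinD lee_fin.
  by apply: (le_trans (EY h m)); rewrite lerD2l hm0.
apply: (@le_trans _ _ (\int[P]_w L w)).
  apply: (integral_le_measurable P N mN N0) => // w Nw.
  have h a : a%:E <= f w -> a%:E <= L w.
    move=> af; have [h0 hh] := fY w Nw a af.
    apply: (le_limn_einf _ _ h0) => h hh0; have [m0 hm0] := hh h hh0.
    by apply: (le_limn_einf _ _ m0) => m mm; rewrite lee_fin hm0.
  have [fy|fy] := eqVneq (f w) +oo.
    by rewrite (@eq_infty _ (L w)) ?leey// => a; apply: h; rewrite fy leey.
  have ff : f w \is a fin_num by rewrite ge0_fin_numE ?ltey// f0.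
  by rewrite -(fineK ff); apply: h; rewrite fineK.
apply: (le_trans (fatou P measurableT mL1 (fun h w _ => L10 h w))).
apply/lee_addgt0Pr => e e0.
pose h0 := (Num.truncn (K1 / e)).+1.
apply: (limn_einf_le _ _ h0) => h hh; apply: (le_trans (EL1 h)).
rewrite -EFinD lee_fin lerD2l ler_pdivrMr// mulrC -ler_pdivrMr//.
apply: (le_trans (ltW (truncnS_gt _))); rewrite ler_nat.
exact: leq_trans hh (leqnSn _).
Qed.

(** A lower bound needs Fatou's lemma in the reverse direction, hence its use on the nonnegative
    [k - min (Y m w) k]. Truncation at level [k] costs at most C / k in mean, since Y - min(Y, k) <=
    Y ^ 2 / k. *)
Lemma limit_le_integral (Y : nat -> T -> R) (v C K : R) :
  (forall m, has_moments P (Y m)) -> (forall m w, (0 <= Y m w)%R) ->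
  (0 <= K)%R -> (0 <= C)%R ->
  (forall m, (v - K * (2 ^+ m)^-1 <= (\int[P]_w Y m w)%R)%R) ->
  (forall m, ((\int[P]_w (Y m w ^+ 2))%R <= C)%R) ->
  (forall w, ~ N w -> exists m0, forall m, (m0 <= m)%N -> (Y m w)%:E <= f w) ->
  v%:E <= \int[P]_w f w.
Proof.
move=> hY Y0 K0 C0 EY EY2 Yf.
have key (k : R) : (0 < k)%R -> (v - C / k)%:E <= \int[P]_w f w.
  move=> k0; pose Z m w := (k - Num.min (Y m w) k)%R.
  have mZ m : measurable_fun setT (Z m).
    apply: measurable_funB => //; apply: measurable_minr => //.
    exact: has_moments_measurable (hY m).
  have Z0 m w : (0 <= Z m w)%R by rewrite subr_ge0 ge_min lexx orbT.
  have Zk m w : (Z m w <= k)%R by rewrite gerBl le_min Y0 ltW.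
  have hZ m : has_moments P (Z m).
    apply: (has_moments_le P _ (fun=> k)) => // [|w]; first exact: has_moments_cst.
    by rewrite !ger0_norm// ltW.
  have EZ m : ((\int[P]_w Z m w)%R <= k - v + C / k + K * (2 ^+ m)^-1)%R.
    have hY2 : has_moments P (fun w => Y m w ^+ 2)%R by exact: has_momentsX.
    have h2 : has_moments P (fun w => k^-1 * Y m w ^+ 2)%R by exact: has_momentsZ.
    have hkY : has_moments P (fun w => k - Y m w)%R.
      by apply: has_momentsB => //; exact: has_moments_cst.
    apply: (@le_trans _ _ (\int[P]_w ((k - Y m w) + k^-1 * Y m w ^+ 2)%R)%R).
      apply: expect_le => // [|w]; first exact: has_momentsD.
      rewrite /Z; case: (leP (Y m w) k) => Yk.
        by rewrite lerDl mulr_ge0 ?invr_ge0 ?sqr_ge0// ltW.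
      rewrite subrr -addrA [(- _ + _)%R]addrC addr_ge0 ?(ltW k0)// subr_ge0.
      rewrite mulrC ler_pdivlMr// expr2 ler_wpM2l// ltW//.
    rewrite expectD// expectB//; last exact: has_moments_cst.
    rewrite expect_cst expectZ//.
    have := EY m; have := EY2 m; move=> h1 h3.
    have h4 : (k^-1 * (\int[P]_w (Y m w ^+ 2))%R <= C / k)%R.
      by rewrite mulrC ler_wpM2r// invr_ge0 ltW.
    lra.
  pose Zi w := limn_einf (fun m => (Z m w)%:E).
  have mZE m : measurable_fun setT (fun w => (Z m w)%:E) by exact/measurable_EFinP.
  have mZi : measurable_fun setT Zi by exact: measurable_fun_limn_einf.
  have Zi0 w : 0 <= Zi w by apply: (le_limn_einf _ _ 0%N) => m _; rewrite lee_fin.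
  have Zik w : Zi w <= k%:E by apply: (limn_einf_le _ _ 0%N) => m _; rewrite lee_fin.
  have Zifin w : Zi w \is a fin_num.
    by rewrite ge0_fin_numE// (le_lt_trans (Zik w))// ltry.
  have EZi : \int[P]_w Zi w <= (k - v + C / k)%:E.
    apply: (le_trans (fatou P measurableT mZE (fun m w _ => Z0 m w))).
    apply/lee_addgt0Pr => e e0; have [m0 hm0] := half_pow_small _ _ K0 e0.
    apply: (limn_einf_le _ _ m0) => m mm; rewrite expect_EFin// -EFinD lee_fin.
    by apply: (le_trans (EZ m)); rewrite lerD2l hm0.
  pose L w := k%:E - Zi w.
  have mL : measurable_fun setT L by apply: emeasurable_funB => //; exact: measurable_cst.
  have L0 w : 0 <= L w by rewrite /L sube_ge0// Zifin.
  have LZ : \int[P]_w L w + \int[P]_w Zi w = k%:E.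
    rewrite -ge0_integralD//.
    under eq_integral do rewrite /L subeK//.
    by rewrite integral_cst//= probability_setT mule1.
  have LE : (v - C / k)%:E <= \int[P]_w L w.
    have -> : (v - C / k)%:E = k%:E - (k - v + C / k)%:E.
      by rewrite -EFinN -EFinD; congr EFin; ring.
    rewrite -{1}LZ leeBlDr//; exact: leeD2l.
  apply: (le_trans LE); apply: (measurable_le_integral P N mN N0) => // w Nw.
  have [m0 hm0] := Yf w Nw; have := f0 w Nw.
  case: (f w) hm0 => [r h _|_ _|h] //; last by rewrite leey.
  rewrite /L leeBlDr// addeC -leeBlDr// -EFinN -EFinD.
  apply: (le_limn_einf _ _ m0) => m mm; rewrite lee_fin lerD2l lerN2.
  by rewrite ge_min -lee_fin h.
apply/lee_addgt0Pr => e e0.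
(* The truncation level (C + 1) / e makes the loss C / k at most [e]; adding 1 keeps it positive
   when [C] is 0. *)
have Ck : (0 < (C + 1) / e)%R by rewrite divr_gt0// ltr_wpDl.
have := key _ Ck; rewrite invf_div => h.
have : (v - C * (e / (C + 1)) + e)%:E <= \int[P]_w f w + e%:E.
  by rewrite EFinD leeD2r.
apply: le_trans; rewrite lee_fin.
have : (C * (e / (C + 1)) <= e)%R.
  by rewrite mulrA ler_pdivrMr ?ltr_wpDl//; nra.
lra.
Qed.

End fatou_bounds.

(** * Brownian motion *)

Section brownian_passage.
Context {R : realType} {d : measure_display} {Omega : measurableType d}.
Variables (P : probability Omega R) (B : R -> {RV P >-> R}).
Hypothesis hB : standard_brownian_motion B.

(** With this mesh, [h.+1 * 2 ^ m] steps end exactly at the horizon [h.+1], which is at least 1 as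
    [rate_bound] requires. *)
Definition mesh (m : nat) : R := (2 ^+ m)^-1.

Lemma mesh_gt0 m : 0 < mesh m.
Proof. by rewrite invr_gt0 exprn_gt0. Qed.

Lemma mesh_le1 m : mesh m <= 1.
Proof. by rewrite invf_le1 ?exprn_gt0// exprn_ege1// ler1n. Qed.

Definition increment (dl : R) (j : nat) (w : Omega) : R :=
  B (j.+1%:R * dl) w - B (j%:R * dl) w.

Lemma measurable_increment dl j : measurable_fun setT (increment dl j).
Proof. exact: measurable_funB. Qed.

Lemma law_increment dl j U : 0 < dl -> measurable U ->
  P (increment dl j @^-1` U) = normal_prob 0 (Num.sqrt dl) U.
Proof.
move=> dl0 mU; have [_ _ law _] := hB.
have := law (j%:R * dl) (j.+1%:R * dl) _ _ U mU.
have -> : j.+1%:R * dl - j%:R * dl = dl by rewrite -mulrBl -natr1 addrAC subrr add0r mul1r.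
by apply; [rewrite mulr_ge0// ltW|rewrite ltr_pM2r// ltr_nat].
Qed.

Lemma indep_increment dl n (U : nat -> set R) : 0 < dl ->
  (forall i, measurable (U i)) ->
  P (\bigcap_(i in `I_n) increment dl i @^-1` U i) =
  (\prod_(i < n) P (increment dl i @^-1` U i))%E.
Proof.
move=> dl0 mU; have [_ indep _ _] := hB.
apply: (indep (fun i => i%:R * dl) n U) => //; first by rewrite mul0r.
by move=> i j ij; rewrite ler_wpM2r ?(ltW dl0)// ler_nat.
Qed.

Lemma sum_increment dl k w :
  \sum_(j < k) increment dl j w = B (k%:R * dl) w - B 0 w.
Proof.
rewrite -(big_mkord xpredT (fun j => increment dl j w)).
by rewrite (telescope_sumr (fun j => B (j%:R * dl) w))// mul0r.
Qed.

Lemma law_sum_increment dl k U : 0 < dl -> (0 < k)%N -> measurable U ->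
  P ((fun w => \sum_(j < k) increment dl j w) @^-1` U) =
  normal_prob 0 (Num.sqrt (k%:R * dl)) U.
Proof.
move=> dl0 k0 mU; have [_ _ law _] := hB.
under eq_fun do rewrite sum_increment.
have := law 0 (k%:R * dl) (lexx _) _ U mU; rewrite subr0; apply.
by rewrite mulr_gt0// ltr0n.
Qed.

Variable mu : R.
Hypothesis mu0 : 0 < mu.

Local Notation step_of dl w := (fun j => increment dl j w - mu * dl).

Definition walk_product (y : R) (h m : nat) (w : Omega) : R :=
  clock (mesh m) y (step_of (mesh m) w) (h.+1 * 2 ^ m) *
  area (mesh m) y (step_of (mesh m) w) (h.+1 * 2 ^ m).

Lemma horizonE h m : (h.+1 * 2 ^ m)%:R * mesh m = h.+1%:R :> R.
Proof. by rewrite natrM natrX mulfK// expf_neq0. Qed.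

Lemma has_moments_walk_product y h m : has_moments P (walk_product y h m).
Proof.
have dl0 := mesh_gt0 m.
have mD := measurable_increment (mesh m).
have lD j U := law_increment (mesh m) j U dl0.
apply: has_momentsM.
- exact: (has_moments_clock P (increment (mesh m)) (mesh m) mu y mD).
- exact: (has_moments_area P (increment (mesh m)) (mesh m) mu y dl0 mD lD).
Qed.

Lemma walk_product_ge0 y h m w : 0 <= walk_product y h m w.
Proof.
have dl0 := ltW (mesh_gt0 m).
by rewrite mulr_ge0 ?clock_ge0 ?area_ge0.
Qed.

Lemma expect_walk_product2 y h m :
  \int[P]_w (walk_product y h m w ^+ 2) <=
  h.+1%:R ^+ 4 * (2 * y ^+ 2 + 2 * h.+1%:R).
Proof.
have dl0 := mesh_gt0 m.
have mD := measurable_increment (mesh m).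
have lD j U := law_increment (mesh m) j U dl0.
have lW j U := law_sum_increment (mesh m) j U dl0.
rewrite -(horizonE h m).
exact: (expect_prod2 P (increment (mesh m)) (mesh m) mu y dl0 mu0 mD lD lW).
Qed.

Lemma expect_walk_product y : 0 <= y -> exists K1 : R, exists K2 : nat -> R,
  [/\ 0 <= K1, forall h, 0 <= K2 h & forall h m,
  `|\int[P]_w walk_product y h m w - mean_product 0 mu y| <=
    K1 / h.+1%:R + K2 h * (2 ^+ m)^-1].
Proof.
move=> y0; have [K1 K10 hK1] := rate_bound mu y mu0.
have /choice[K2 hK2] : forall h : nat, exists K2 : R, 0 <= K2 /\ forall m,
  `|\int[P]_w walk_product y h m w - mean_product 0 mu y| <=
    K1 / h.+1%:R + K2 * (2 ^+ m)^-1.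
  move=> h; have H1 : 1 <= h.+1%:R :> R by rewrite ler1n.
  have [K2 K20 hK2] := hK1 _ H1; exists K2; split=> // m.
  have dl0 := mesh_gt0 m; have dl1 := mesh_le1 m.
  have mD := measurable_increment (mesh m).
  have lD j U := law_increment (mesh m) j U dl0.
  have iD n U := indep_increment (mesh m) n U dl0.
  have lW j U := law_sum_increment (mesh m) j U dl0.
  have e0 : 0 < h.+1%:R ^- 4 :> R by rewrite invr_gt0 exprn_gt0.
  have e1 : h.+1%:R ^- 4 <= 1 :> R by rewrite invf_le1 ?exprn_gt0// exprn_ege1.
  apply: le_trans (hK2 _ dl0).
  rewrite -[X in `|X|](subrKA (mean_product (mesh m) mu y)).
  apply: (le_trans (ler_normD _ _)); rewrite lerD2r.
  exact: (expect_prod_close P (increment (mesh m)) (mesh m) mu y dl0 dl1 mu0 y0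
    mD lD iD lW _ _ _ (esym (horizonE h m)) H1 e0 e1).
by exists K1, K2; split=> // [h|h m]; have [] := hK2 h.
Qed.

Section path.
Variables (x : R) (w : Omega).
Hypothesis x0 : 0 <= x.
Hypothesis Bw0 : B 0 w = 0.
Hypothesis Bwc : {within `[0, +oo[, continuous (fun t => B t w)}.

Local Notation X := (fun t => drifted B mu x t w).

Let X0 : X 0 = x.
Proof. by rewrite /drifted Bw0 mulr0 subr0 addr0. Qed.

Let UC (H e : R) : 0 < e -> exists2 r : R, 0 < r &
  forall s t, 0 <= s -> s <= H -> 0 <= t -> t <= H -> `|s - t| <= r -> `|X s - X t| <= e.
Proof.
move=> e0; have e20 : 0 < e / 2 by rewrite divr_gt0.
have [r r0 hr] := within_uniform_continuous _ Bwc H _ e20.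
exists (Num.min r (e / 2 / mu)); first by rewrite lt_min r0 divr_gt0.
move=> s t s0 sH t0 tH; rewrite le_min => /andP[st1 st2].
rewrite /drifted (_ : _ - _ = - (mu * (s - t)) + (B s w - B t w)); last by ring.
apply: (le_trans (ler_normD _ _)); rewrite normrN normrM (gtr0_norm mu0).
have := hr s t s0 sH t0 tH st1.
by move: st2; rewrite ler_pdivlMr// mulrC; lra.
Qed.

Let stepE m : step_of (mesh m) w = (fun j => X (j.+1%:R * mesh m) - X (j%:R * mesh m)).
Proof. by apply/funext => j; rewrite /drifted /increment -natr1; ring. Qed.

Let osc_small h eta : 0 < eta -> exists m0 : nat, forall m, (m0 <= m)%N ->
  forall s t, 0 <= s -> s <= (h.+1 * 2 ^ m)%:R * mesh m -> 0 <= t ->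
  t <= (h.+1 * 2 ^ m)%:R * mesh m -> `|s - t| <= mesh m -> `|X s - X t| <= eta.
Proof.
move=> eta0; have [r r0 hr] := UC h.+1%:R _ eta0.
have [m0 hm0] := half_pow_small 1 r ler01 r0.
exists m0 => m mm s t s0 sH t0 tH st; rewrite !horizonE in sH tH.
by apply: hr => //; apply: (le_trans st); have := hm0 m mm; rewrite mul1r.
Qed.

Lemma time_area_ge0 : (0 <= first_passage_time B mu x w * first_passage_area B mu x w)%E.
Proof.
have X00 : 0 <= X 0 by rewrite X0.
exact: mule_ge0 (passage_time_ge0 X) (passage_area_ge0 X X00 UC).
Qed.

Lemma walk_product_le eta h : 0 < eta -> exists m0 : nat, forall m, (m0 <= m)%N ->
  ((walk_product (x - eta) h m w)%:E <=
   first_passage_time B mu x w * first_passage_area B mu x w)%E.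
Proof.
move=> eta0; have [m0 hm0] := osc_small h _ eta0; exists m0 => m mm.
have X00 : 0 <= X 0 by rewrite X0.
have := prod_le_passage X X00 UC (mesh m) eta _ (mesh_gt0 m) (hm0 m mm).
by rewrite X0 -stepE.
Qed.

Lemma le_walk_product eta (a : R) : 0 < eta ->
  (a%:E <= first_passage_time B mu x w * first_passage_area B mu x w)%E ->
  exists h0 : nat, forall h, (h0 <= h)%N -> exists m0 : nat, forall m, (m0 <= m)%N ->
  a <= walk_product (x + eta) h m w.
Proof.
move=> eta0 af; have X00 : 0 <= X 0 by rewrite X0.
have [Ty|Ty] := eqVneq (passage_time X) +oo%E.
(* With H = h + 1 >= 1 the product is at least eta H ^ 2 >= eta H, which exceeds |a| from this index
   on. *)
- pose h0 := Num.truncn (`|a| / eta); exists h0 => h hh.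
  have [m0 hm0] := osc_small h _ eta0; exists m0 => m mm.
  have := prod_ge_of_no_passage X X00 UC (mesh m) eta _ (mesh_gt0 m) eta0 Ty.
  move=> /(_ (h.+1 * 2 ^ m)%N); rewrite X0 -stepE horizonE; apply: le_trans.
  apply: (le_trans (ler_norm a)); rewrite mulrC -ler_pdivrMr//.
  have h1 : 1 <= h.+1%:R :> R by rewrite ler1n.
  apply: (@le_trans _ _ (h.+1%:R : R)); last by rewrite expr2 ler_peMl.
  by apply: (le_trans (ltW (truncnS_gt _))); rewrite ler_nat ltnS.
- have T0 := passage_time_ge0 X.
  have Tf : passage_time X \is a fin_num by rewrite ge0_fin_numE ?ltey.
  pose h0 := Num.truncn (fine (passage_time X)); exists h0 => h hh.
  have [m0 hm0] := osc_small h _ eta0; exists m0 => m mm.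
  have Th : (passage_time X < ((h.+1 * 2 ^ m)%:R * mesh m)%:E)%E.
    rewrite horizonE -(fineK Tf) lte_fin (lt_le_trans (truncnS_gt _))//.
    by rewrite ler_nat ltnS.
  have := passage_le_prod X X00 UC (mesh m) eta _ (mesh_gt0 m) eta0 (hm0 m mm) Th.
  rewrite X0 -stepE => h1; rewrite -lee_fin; exact: le_trans af h1.
Qed.

End path.

Lemma brownian_null_set : exists N : set Omega, [/\ measurable N, P N = 0 &
  forall w, ~ N w -> B 0 w = 0 /\ {within `[0, +oo[, continuous (fun t => B t w)}].
Proof.
have [[N1 [mN1 N10 s1]] _ _ [N2 [mN2 N20 s2]]] := hB.
exists (N1 `|` N2); split; first exact: measurableU.
  by rewrite measureU0.
move=> w /not_orP[n1 n2]; split.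
  by apply: contrapT => h; apply: n1; exact: s1.
by apply: contrapT => h; apply: n2; exact: s2.
Qed.

Lemma mean_time_area_le x eta : 0 <= x -> 0 < eta ->
  (mean_time_area B mu x <= (mean_product 0 mu (x + eta))%:E)%E.
Proof.
move=> x0 eta0; have [N [mN N0 hN]] := brownian_null_set.
have y0 : 0 <= x + eta by rewrite addr_ge0// ltW.
have [K1 [K2 [K10 K20 EY]]] := expect_walk_product _ y0.
apply: (integral_le_double_limit P N mN N0 _ _ (walk_product (x + eta)) _ K1 K2) => //.
- by move=> w /hN[Bw0 Bwc]; exact: time_area_ge0.
- exact: has_moments_walk_product.
- exact: walk_product_ge0.
- by move=> h m; have := EY h m; rewrite ler_norml lerBlDl addrA => /andP[].
- by move=> w /hN[Bw0 Bwc] a; exact: le_walk_product.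
Qed.

Lemma mean_time_area_ge x eta : 0 < eta -> eta <= x ->
  ((mean_product 0 mu (x - eta))%:E <= mean_time_area B mu x)%E.
Proof.
move=> eta0 etax; have [N [mN N0 hN]] := brownian_null_set.
have x0 : 0 <= x := le_trans (ltW eta0) etax.
have y0 : 0 <= x - eta by rewrite subr_ge0.
have [K1 [K2 [K10 K20 EY]]] := expect_walk_product _ y0.
(* The horizon stays fixed here, since the second moment bound used for truncation is uniform in the
   mesh but grows with [h]. *)
have key h : ((mean_product 0 mu (x - eta) - K1 / h.+1%:R)%:E <= mean_time_area B mu x)%E.
  apply: (limit_le_integral P N mN N0 _ _ (walk_product (x - eta) h) _
    (h.+1%:R ^+ 4 * (2 * (x - eta) ^+ 2 + 2 * h.+1%:R)) (K2 h)) => //.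
  - by move=> w /hN[Bw0 Bwc]; exact: time_area_ge0.
  - exact: has_moments_walk_product.
  - exact: walk_product_ge0.
  - apply: mulr_ge0; first exact: exprn_ge0.
    by have := sqr_ge0 (x - eta); have := ler0n R h.+1; lra.
  - by move=> m; have := EY h m; rewrite ler_norml lerBrDl opprD addrA => /andP[].
  - by move=> m; exact: expect_walk_product2.
  - by move=> w /hN[Bw0 Bwc]; exact: walk_product_le.
apply/lee_addgt0Pr => e e0; pose h := Num.truncn (K1 / e).
apply: (@le_trans _ _ ((mean_product 0 mu (x - eta) - K1 / h.+1%:R) + e)%:E).
  rewrite lee_fin -addrA lerDl addrC subr_ge0 ler_pdivrMr// mulrC -ler_pdivrMr//.
  exact: ltW (truncnS_gt _).
by rewrite EFinD leeD2r.
Qed.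

Lemma mean_product_lip x : 0 <= x -> exists2 K : R, 0 <= K & forall eta,
  0 < eta -> eta <= 1 -> `|mean_product 0 mu (x + eta) - mean_product 0 mu x| <= K * eta.
Proof.
move=> x0.
have p2 : 0 < (2 * mu ^+ 2)^-1 by rewrite invr_gt0 mulr_gt0// exprn_gt0.
have p3 : 0 < mu ^- 3 by rewrite invr_gt0 exprn_gt0.
have p4 : 0 < mu ^- 4 by rewrite invr_gt0 exprn_gt0.
exists ((3 * x ^+ 2 + 3 * x + 1) * (2 * mu ^+ 2)^-1 + (2 * x + 1) * mu ^- 3 + mu ^- 4).
  by have := sqr_ge0 x; nra.
move=> eta eta0 eta1; rewrite /mean_product mul0r addr0.
rewrite (_ : _ - _ = eta * ((3 * x ^+ 2 + 3 * x * eta + eta ^+ 2) * (2 * mu ^+ 2)^-1 +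
  (2 * x + eta) * mu ^- 3 + mu ^- 4)); last by ring.
have e2 : eta ^+ 2 <= 1 by rewrite exprn_ile1// ltW.
have xe : x * eta <= x by rewrite ler_piMr.
have xe0 : 0 <= x * eta by rewrite mulr_ge0// ltW.
have q0 := sqr_ge0 eta; have x20 := sqr_ge0 x.
have A0 : 0 <= (3 * x ^+ 2 + 3 * x * eta + eta ^+ 2) * (2 * mu ^+ 2)^-1.
  by apply: mulr_ge0; [lra|exact: ltW].
have B0 : 0 <= (2 * x + eta) * mu ^- 3 by apply: mulr_ge0; [lra|exact: ltW].
rewrite ger0_norm; last first.
  by apply: mulr_ge0; [exact: ltW|rewrite !addr_ge0// ltW].
rewrite mulrC ler_wpM2r ?(ltW eta0)// lerD2r; apply: lerD.
  by rewrite ler_wpM2r ?(ltW p2)//; lra.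
by rewrite ler_wpM2r ?(ltW p3)//; lra.
Qed.

Lemma mean_time_areaE x : 0 <= x -> mean_time_area B mu x = (mean_product 0 mu x)%:E.
Proof.
move=> x0; apply/le_anti/andP; split.
- have [K K0 hK] := mean_product_lip _ x0.
  apply/lee_addgt0Pr => e e0.
  pose eta := Num.min 1 (e / (K + 1)).
  have K1 : 0 < K + 1 by rewrite ltr_wpDl.
  have eta0 : 0 < eta by rewrite lt_min ltr01 divr_gt0.
  have eta1 : eta <= 1 by rewrite ge_min lexx.
  have etae : eta * (K + 1) <= e by rewrite -ler_pdivlMr// ge_min lexx orbT.
  apply: (le_trans (mean_time_area_le _ _ x0 eta0)); rewrite -EFinD lee_fin.
  by have := hK _ eta0 eta1; rewrite ler_norml => /andP[_]; nra.
(* At 0 there is no room for a walk starting lower; the lower bound is the nonnegativity of the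
   product. *)
- have [->|xn0] := eqVneq x 0.
    have -> : mean_product 0 mu 0 = 0 by rewrite /mean_product !expr0n/= !mul0r mulr0 !addr0.
    have [N [mN N0 hN]] := brownian_null_set.
    rewrite (_ : 0%:E = \int[P]_w (cst 0 w))%E; last by rewrite integral0.
    apply: (measurable_le_integral P N mN N0) => // w /hN[Bw0 Bwc]; exact: time_area_ge0.
  have {xn0}x0 : 0 < x by rewrite lt_neqAle eq_sym xn0.
  apply/lee_addgt0Pr => e e0.
  have [K K0 hK] : exists2 K : R, 0 <= K & forall eta, 0 < eta -> eta <= x -> eta <= 1 ->
      mean_product 0 mu x - mean_product 0 mu (x - eta) <= K * eta.
    have p2 : 0 < (2 * mu ^+ 2)^-1 by rewrite invr_gt0 mulr_gt0// exprn_gt0.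
    have p3 : 0 < mu ^- 3 by rewrite invr_gt0 exprn_gt0.
    have p4 : 0 < mu ^- 4 by rewrite invr_gt0 exprn_gt0.
    exists ((3 * x ^+ 2 + 1) * (2 * mu ^+ 2)^-1 + (2 * x) * mu ^- 3 + mu ^- 4).
      by have := sqr_ge0 x; nra.
    move=> eta eta0 etax eta1; rewrite /mean_product mul0r addr0.
    rewrite (_ : _ - _ = ((3 * x ^+ 2 - 3 * x * eta + eta ^+ 2) * (2 * mu ^+ 2)^-1 +
      (2 * x - eta) * mu ^- 3 + mu ^- 4) * eta); last by ring.
    have e2 : eta ^+ 2 <= 1 by rewrite exprn_ile1// ltW.
    have xe0 : 0 <= x * eta by rewrite mulr_ge0// ltW.
    rewrite ler_wpM2r ?(ltW eta0)// lerD2r; apply: lerD.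
      by rewrite ler_wpM2r ?(ltW p2)//; lra.
    by rewrite ler_wpM2r ?(ltW p3)//; lra.
  pose eta := Num.min x (Num.min 1 (e / (K + 1))).
  have K1 : 0 < K + 1 by rewrite ltr_wpDl.
  have eta0 : 0 < eta by rewrite !lt_min x0 ltr01 divr_gt0.
  have etax : eta <= x by rewrite ge_min lexx.
  have eta1 : eta <= 1 by rewrite !ge_min lexx orbT.
  have etae : eta * (K + 1) <= e by rewrite -ler_pdivlMr// !ge_min lexx !orbT.
  apply: (@le_trans _ _ (mean_product 0 mu (x - eta) + e)%:E).
    by rewrite lee_fin; have := hK _ eta0 etax eta1; nra.
  by rewrite EFinD leeD2r// mean_time_area_ge.
Qed.

End brownian_passage.

(** * The boundary value problem *)

Section boundary_value_problem.
Context {R : realType}.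
Implicit Types mu x c : R.

Local Notation V := (mean_product 0).

Lemma mean_product0E mu : V mu =
  (fun x => x ^+ 3 * (2 * mu ^+ 2)^-1 + x ^+ 2 * mu ^- 3 + x * mu ^- 4).
Proof.
by apply/funext => x; rewrite /mean_product mul0r addr0 [mu ^- 3 * _]mulrC.
Qed.

Lemma is_derive_mean_product mu x : is_derive x 1 (V mu)
  (3 * x ^+ 2 * (2 * mu ^+ 2)^-1 + 2 * x * mu ^- 3 + mu ^- 4).
Proof.
rewrite mean_product0E; apply: is_derive_eq.
rewrite /GRing.scale/=; ring.
Qed.

Lemma derive1_mean_product mu : derive1 (V mu) =
  (fun x => 3 * x ^+ 2 * (2 * mu ^+ 2)^-1 + 2 * x * mu ^- 3 + mu ^- 4).
Proof.
apply/funext => x; rewrite derive1E.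
by have [_ ->] := is_derive_mean_product mu x.
Qed.

Lemma is_derive2_mean_product mu x : is_derive x 1 (derive1 (V mu))
  (6 * x * (2 * mu ^+ 2)^-1 + 2 * mu ^- 3).
Proof.
rewrite derive1_mean_product; apply: is_derive_eq.
rewrite /GRing.scale/=; ring.
Qed.

Lemma near_gt0 x : 0 < x -> \forall y \near x, 0 < y.
Proof. by move=> x0; apply: lt_nbhsr. Qed.

(** [V] is identified with the polynomial only on the half-line, so derivatives are compared at
    positive points, through neighbourhoods that stay positive. *)
Lemma derive1_near_eq (f g : R -> R) x : 0 < x ->
  (forall y, 0 < y -> f y = g y) -> derive1 f x = derive1 g x.
Proof.
move=> x0 fg; rewrite !derive1E; apply: near_eq_derive.
by near=> y; apply: fg; near: y; exact: near_gt0.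
Unshelve. all: by end_near. Qed.

Lemma derivable_near_eq (f g : R -> R) x : 0 < x ->
  (forall y, 0 < y -> f y = g y) -> derivable g x 1 -> derivable f x 1.
Proof.
move=> x0 fg; apply: near_eq_derivable.
by near=> y; apply/esym/fg; near: y; exact: near_gt0.
Unshelve. all: by end_near. Qed.

Lemma solves_ode_eq mu (f : R -> R) : 0 < mu ->
  (forall x, 0 <= x -> f x = V mu x) -> solves_ode mu f.
Proof.
move=> mu0 fV.
have fV' x : 0 < x -> f x = V mu x by move=> /ltW; exact: fV.
have f0 : f 0 = 0.
  by rewrite fV// mean_product0E !expr0n/= !mul0r !addr0.
split=> //.
- move=> x x0; have d1 := is_derive_mean_product mu x.
  have d2 := is_derive2_mean_product mu x.
  have e1 y : 0 < y -> derive1 f y = derive1 (V mu) y.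
    by move=> y0; exact: derive1_near_eq.
  split.
  + by apply: (derivable_near_eq f (V mu)) => //; have [] := d1.
  + by apply: (derivable_near_eq _ (derive1 (V mu))) => //; have [] := d2.
  + rewrite (derive1_near_eq _ (derive1 (V mu)) x x0 e1) e1//.
    rewrite [derive1 (derive1 _) x]derive1E; have [_ ->] := d2.
    by rewrite derive1_mean_product; field; rewrite gt_eqF.
- rewrite f0 -[X in _ --> X](_ : V mu 0 = 0); last by rewrite -fV.
  have cV : {for 0, continuous (V mu)}.
    apply: differentiable_continuous; apply/derivable1_diffP.
    by have [] := is_derive_mean_product mu 0.
  apply: (cvg_trans _ (cvg_at_right_filter cV)).
  apply: near_eq_cvg; near=> y; rewrite fV//.
Unshelve. all: by end_near. Qed.

Lemma mean_product_small x (e : R) : 0 < e -> exists M : R, forall mu, M < mu ->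
  0 < mu /\ `|V mu x| <= e.
Proof.
move=> e0; pose K := `|x ^+ 3| + `|x ^+ 2| + `|x|.
have K0 : 0 <= K by rewrite !addr_ge0.
(* The 1 ensures mu >= 1, so that every power of 1 / mu involved is at most 1 / mu; then [K / e]
   ensures K / mu <= e. *)
exists (1 + K / e) => mu hmu.
have m1 : 1 <= mu by apply: ltW; apply: le_lt_trans hmu; rewrite lerDl divr_ge0// ltW.
have mu0 : 0 < mu := lt_le_trans ltr01 m1.
have Ke : K / mu <= e.
  rewrite ler_pdivrMr// mulrC -ler_pdivrMr// ltW//.
  by apply: le_lt_trans hmu; rewrite lerDr.
split=> //; apply: le_trans Ke; rewrite mean_product0E.
have i1 : mu^-1 <= 1 by rewrite invf_le1.
have i0 : 0 <= mu^-1 by rewrite invr_ge0 ltW.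
have p k : mu ^- k.+1 <= mu^-1.
  by rewrite -exprVn exprS ler_piMr// exprn_ile1.
have p0 k : 0 <= mu ^- k by rewrite -exprVn exprn_ge0.
have q : (2 * mu ^+ 2)^-1 <= mu^-1.
  by rewrite invfM; apply: (le_trans _ (p 1%N)); rewrite ler_piMl// invf_le1// ler1n.
have q0 : 0 <= (2 * mu ^+ 2)^-1 by rewrite invr_ge0 mulr_ge0// exprn_ge0 ?ltW.
apply: (le_trans (ler_normD _ _)); rewrite /K [leRHS]mulrDl [X in _ <= X + _]mulrDl; apply: lerD.
  apply: (le_trans (ler_normD _ _)); apply: lerD.
    by rewrite normrM (ger0_norm q0) ler_wpM2l.
  by rewrite normrM (ger0_norm (p0 3%N)) ler_wpM2l// p.
by rewrite normrM (ger0_norm (p0 4%N)) ler_wpM2l// p.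
Qed.

(** The difference [u] of the derivatives satisfies u' = 2 mu u, so u expR (- 2 mu x) is constant on
    the open half-line. Integrating once more leaves an additive constant, which right-continuity
    and the value at 0 identify as - c. *)
Lemma solves_ode_unique mu (f g : R -> R) : 0 < mu ->
  solves_ode mu f -> solves_ode mu g ->
  exists c : R, forall x, 0 <= x -> f x = g x + c * (expR (2 * mu * x) - 1).
Proof.
move=> mu0 [odef cf f0] [odeg cg g0].
have p2 : 2 * mu != 0 by rewrite mulf_neq0// gt_eqF.
have alg (a b p q : R) : 2^-1 * a - mu * p = 2^-1 * b - mu * q ->
    a - b = 2 * mu * (p - q).
  move=> h; rewrite [LHS](_ : _ = 2 * ((2^-1 * a - mu * p) - (2^-1 * b - mu * q)) +
    2 * mu * (p - q)); last by field.
  by rewrite h subrr mulr0 add0r.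
pose u x := derive1 f x - derive1 g x.
pose k x := u x * expR (- (2 * mu) * x).
have du x : 0 < x -> is_derive x 1 u (2 * mu * u x).
  move=> x0; have [_ df2 ef] := odef x x0; have [_ dg2 eg] := odeg x x0.
  have hf := DeriveDef df2 (esym (derive1E (derive1 f) x)).
  have hg := DeriveDef dg2 (esym (derive1E (derive1 g) x)).
  have := is_deriveB hf hg; rewrite /u => h; apply: (is_derive_eq h).
  exact: alg (etrans ef (esym eg)).
have de a x : is_derive x 1 (fun y : R => expR (a * y)) (a * expR (a * x)).
  have h : is_derive x 1 (fun y : R => a * y) a.
    by apply: is_derive_eq; rewrite /GRing.scale/=; ring.
  by apply: is_derive_eq; rewrite /GRing.scale/=; ring.
have dk x : 0 < x -> is_derive x 1 k 0.
  move=> x0; have h1 := du x x0; have h2 := de (- (2 * mu)) x.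
  have := is_deriveM h1 h2 => h; apply: (is_derive_eq h).
  by rewrite /GRing.scale/=; ring.
have cst (h : R -> R) : (forall x, 0 < x -> is_derive x 1 h 0) ->
    forall x y, 0 < x -> 0 < y -> h x = h y.
  move=> dh x y; wlog xy : x y / x < y => [hw x0 y0|x0 y0].
    have [xy|yx|->//] := ltgtP x y; first exact: hw.
    by apply/esym/hw.
  have dh' z : z \in `]x, y[ -> is_derive z 1 h ((fun=> 0) z).
    by rewrite in_itv/= => /andP[xz _]; apply: dh; exact: lt_trans xz.
  have ch : {within `[x, y], continuous h}.
    apply: derivable_within_continuous => z; rewrite in_itv/= => /andP[xz _].
    by have [] := dh z (lt_le_trans x0 xz).
  by have [z _ /eqP] := MVT xy dh' ch; rewrite mul0r subr_eq0 => /eqP.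
(* Chosen so that c expR (2 mu x) has derivative k expR (2 mu x), which is [u]. *)
pose c := k 1 / (2 * mu).
pose r x := f x - g x - c * expR (2 * mu * x).
have dr x : 0 < x -> is_derive x 1 r 0.
  move=> x0; have [df _ _] := odef x x0; have [dg _ _] := odeg x x0.
  have hf := DeriveDef df (esym (derive1E f x)).
  have hg := DeriveDef dg (esym (derive1E g x)).
  have he : is_derive x 1 (fun y => c * expR (2 * mu * y)) (c * (2 * mu * expR (2 * mu * x))).
    have h := de (2 * mu) x.
    by apply: is_derive_eq; rewrite /GRing.scale/=; ring.
  have := is_deriveB (is_deriveB hf hg) he => h; apply: (is_derive_eq h).
  have kx : k x = k 1 by apply: (cst k).
  rewrite -/(u x) mulrA divfK// -kx /k -mulrA -expRD mulNr addNr expR0 mulr1.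
  by rewrite subrr.
have r1 x : 0 < x -> r x = - c.
  move=> x0.
  have cr : r y @[y --> 0^'+] --> f 0 - g 0 - c * expR (2 * mu * 0).
    apply: cvgB; first exact: cvgB.
    have ce : {for 0, continuous (fun y : R => expR (2 * mu * y))}.
      apply: differentiable_continuous; apply/derivable1_diffP.
      by have [] := de (2 * mu) 0.
    by apply: cvgMr; exact: cvg_at_right_filter ce.
  have cr' : r y @[y --> 0^'+] --> r x.
    apply: cvg_near_cst; near=> y; apply: (cst r) => //; near: y; exact: nbhs_right_gt.
  have := cvg_unique _ cr' cr => ->//.
  by rewrite f0 g0 mulr0 expR0 mulr1 subr0 sub0r.
exists c => x; rewrite le_eqVlt => /predU1P[<-|x0].
  by rewrite f0 g0 mulr0 expR0 subrr mulr0 addr0.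
by have := r1 x x0; rewrite /r; lra.
Unshelve. all: by end_near. Qed.

(** Evaluated at x = 1, the exponential mode has a factor at least 1 as soon as mu >= 1, so it can
    vanish in the limit only if [c] does. *)
Lemma exp_mode_eq0 (c : R) (g : R -> R) :
  g mu @[mu --> +oo] --> (0 : R) ->
  g mu + c * (expR (2 * mu * 1) - 1) @[mu --> +oo] --> (0 : R) -> c = 0.
Proof.
move=> g0 gc0.
have h : c * (expR (2 * mu * 1) - 1) @[mu --> +oo] --> (0 : R).
  rewrite -[X in _ --> X](subrr 0) (_ : (fun mu => _) = (fun mu =>
    g mu + c * (expR (2 * mu * 1) - 1) - g mu)); first exact: cvgB.
  by apply/funext => mu; rewrite addrAC subrr add0r.
apply/eqP; rewrite -normr_le0; apply/ler_addgt0Pr => e e0; rewrite add0r.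
have /cvgrPdist_lt/(_ e e0) he := h.
near (pinfty_nbhs R) => mu; have mu1 : 1 <= mu by near: mu; apply: nbhs_pinfty_ge; exact: num_real.
have : `|0 - c * (expR (2 * mu * 1) - 1)| < e by near: mu.
rewrite sub0r normrN normrM => hc; apply: le_trans (ltW hc).
rewrite ler_peMr// (le_trans _ (ler_norm _))// lerBrDr.
by apply: (le_trans _ (expR_ge1Dx _)); lra.
Unshelve. all: by end_near. Qed.

End boundary_value_problem.

(* Besides solving the problem, V is singled out by it as follows: the equation
   and the value at 0 leave one free constant c, which the limit condition
   forces to be 0. (If c may depend on mu, the problem has further solutions:
   take c = expR (- mu ^+ 2).) *)
Theorem theorem2p2 (R : realType) (d : measure_display)
    (Omega : measurableType d) (P : probability Omega R)
    (B : R -> {RV P >-> R}) (hB : standard_brownian_motion B) :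
  let V := fun mu x : R => fine (mean_time_area B mu x) in
  [/\ forall mu x : R, 0 < mu -> 0 <= x -> mean_time_area B mu x \is a fin_num,
      solves_problem V,
      forall (mu : R) (f : R -> R), 0 < mu -> solves_ode mu f ->
        exists c : R, forall x : R, 0 <= x ->
          f x = V mu x + c * (expR (2 * mu * x) - 1) &
      forall c : R,
        solves_problem (fun mu x => V mu x + c * (expR (2 * mu * x) - 1)) ->
        c = 0].
Proof.
move=> V.
have VE mu x : 0 < mu -> 0 <= x -> V mu x = mean_product 0 mu x.
  by move=> mu0 x0; rewrite /V (mean_time_areaE P B hB mu mu0 x x0).
have odeV mu : 0 < mu -> solves_ode mu (V mu).
  by move=> mu0; apply: solves_ode_eq => // x; exact: VE.
have limV x : 0 < x -> V mu x @[mu --> +oo] --> (0 : R).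
  move=> x0; apply/cvgrPdist_le => e e0; have [M hM] := mean_product_small x e e0.
  near=> mu; have [mu0 h] : 0 < mu /\ `|mean_product 0 mu x| <= e.
    by apply: hM; near: mu; apply: nbhs_pinfty_gt; exact: num_real.
  by rewrite sub0r normrN VE// ltW.
split=> //.
- by move=> mu x mu0 x0; rewrite (mean_time_areaE P B hB mu mu0 x x0).
- by move=> mu f mu0 odef; exact: solves_ode_unique (odeV mu mu0).
- move=> c [_ /(_ 1 ltr01)]; exact: exp_mode_eq0 (limV 1 ltr01).
Unshelve. all: by end_near. Qed.
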